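(* In the setting described in the context, let $x(t)$, $t\ge0$, be the solution, from a given initial value $x(0)\in\mathbb R^N$, of $$\dot x_i=\varsigma(t)\Big(\mathcal P_{\Omega_i}\big[x_i-\gamma(t)\big(\nabla_{x_i}f_i(x)+\varepsilon(t)\nabla_{x_i}P(x)+\delta(t)x_i\big)\big]-x_i\Big),\quad i=1,\dots,N.$$ Put $$r_1(t)=-\gamma^2(t)\big(Nb_1^2+Nb_2^2\varepsilon^2(t)+\delta^2(t)\big)+2\gamma(t)\delta(t),\quad r_2(t)=\frac{|\dot\delta(t)|+|\dot\varepsilon(t)|}{\delta(t)},\quad E_{r_1\varsigma}(t)=\int_0^t\frac{r_1(s)\varsigma(s)}{2}\,ds.$$ Suppose that: (i) $0<r_1(t)<1$ for all $t\ge0$; $\lim_{t\to\infty}\frac{r_2(t)}{r_1(t)\varsigma(t)}=0$; $\lim_{t\to\infty}\int_0^tr_1(s)\varsigma(s)\,ds=\infty$; and $\int_0^tr_2(s)e^{E_{r_1\varsigma}(s)}ds$ is either bounded in $t$ or tends to $\infty$ as $t\to\infty$; (ii) $\dfrac{\int_0^tr_2(s)e^{E_{r_1\varsigma}(s)}ds}{e^{E_{r_1\varsigma}(t)}}\le c_0$ for all $t\ge0$; (iii) $\lim_{t\to\infty}\delta(t)=0$, $\lim_{t\to\infty}\delta^2(t)\varepsilon(t)=\infty$, $\lim_{t\to\infty}\varepsilon(t)=\infty$. Then $\lim_{t\to\infty}x(t)=x^*$, where $x^*$ is the least-norm variational equilibrium of the game.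
   Context: Game. There are $N$ players $\{1,\dots,N\}$; player $i$ chooses $x_i\in\Omega_i\subset\mathbb R$ and solves $\min_{x_i\in\Omega_i}f_i(x_i,x_{-i})$ subject to the shared constraint $g(x)=Ax-b\le0$ (componentwise), where $x=[x_1,\dots,x_N]^T$, $A\in\mathbb R^{n\times N}$, $b\in\mathbb R^n$, $f_i:\mathbb R^N\to\mathbb R$. Standing assumptions. (1) Each $f_i$ is twice continuously differentiable on $\mathbb R^N$ and convex in $x_i\in\mathbb R$ for every $x_{-i}\in\mathbb R^{N-1}$. (2) $F(x)=[\nabla_{x_1}f_1(x),\dots,\nabla_{x_N}f_N(x)]^T$ is monotone on $\mathbb R^N$: $(F(x)-F(y))^T(x-y)\ge0$. (3) Each $\Omega_i$ is nonempty, convex and compact, and with $\Omega=\Omega_1\times\cdots\times\Omega_N$ the set $Q=\{x\in\Omega: g(x)\le0\}$ satisfies Slater's condition (there is $x_{\rm int}\in\Omega$ with $Ax_{\rm int}-b<0$ componentwise). VI. For a convex set $K$ and a map $\Phi$, VI$(K,\Phi)$ asks for $x\in K$ with $(y-x)^T\Phi(x)\ge0$ for all $y\in K$. A variational equilibrium of the game is a solution of VI$(Q,F)$; $x^*$ is the unique solution of VI$(Q,F)$ of least Euclidean norm. $\mathcal P_K$ is Euclidean projection onto $K$; $\|\cdot\|$ is the Euclidean norm. Penalty. $P(x)=\sum_{k=1}^nP_k(x)$, $P_k(x)=0$ if $g_k(x)\le0$ and $P_k(x)=(g_k(x))^2$ otherwise, where $g_k$ is the $k$-th component of $g$. Parameters.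 $\delta,\varepsilon,\varsigma,\gamma:[0,\infty)\to(0,\infty)$ are smooth with finite initial values. $x_t^*$ denotes the unique solution of VI$(\Omega,\Phi_{\delta\varepsilon})$ at time $t$, where $\Phi_{\delta\varepsilon}(x)=F(x)+\delta(t)x+\varepsilon(t)\nabla_xP(x)$. Constants. $c_x,c_p>0$ are such that $\|x\|\le c_x$ and $\|\nabla_xP(x)\|\le c_p$ for all $x\in\Omega$; $c_{px}=\max\{c_x,c_p\}$. $c_0>0$ is a constant independent of $b_1$, and $c>0$ satisfies $c_{px}c_0\le c$. Let $q(0)=x(0)-x_0^*$ (with $x_0^*$ denoting $x_t^*$ at $t=0$). The local Lipschitz constant $b_1>0$ (dependent on the initial values) is such that, for every $i$, $|\nabla_{x_i}f_i(x)-\nabla_{x_i}f_i(x_t^* )|\le b_1\|x-x_t^*\|$ for all $t\ge0$ and all $x$ with $\|x\|\le\|q(0)\|+c+c_x$. $b_2>0$ is a global Lipschitz constant of $\nabla_{x_i}P$ on $\mathbb R^N$ for every $i$. *)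

(* Defs.v *)
From HB Require Import structures.
From mathcomp Require Import all_boot all_order all_algebra.
From mathcomp Require Import all_classical all_reals all_analysis.

Set Implicit Arguments.
Unset Strict Implicit.
Unset Printing Implicit Defensive.

Import Order.TTheory GRing.Theory Num.Theory.
Import numFieldNormedType.Exports.

Local Open Scope classical_set_scope.
Local Open Scope ring_scope.

Section Euclidean.
Context {R : realType} {N : nat}.
Implicit Types x y : 'cV[R]_N.

Definition dotp x y : R := \sum_i x i 0 * y i 0.

(* The library norm on matrices is the max norm; [enorm] is the l2 norm. *)
Definition enorm x : R := Num.sqrt (dotp x x).

Definition partial (i : 'I_N) (h : 'cV[R]_N -> R) (x : 'cV[R]_N) : R :=
  'D_(delta_mx i 0 : 'cV[R]_N) h x.

Definition gradient (h : 'cV[R]_N -> R) (x : 'cV[R]_N) : 'cV[R]_N :=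
  \col_i partial i h x.

Definition C1 (h : 'cV[R]_N -> R) : Prop :=
  forall i : 'I_N, (forall x, derivable h x (delta_mx i 0 : 'cV[R]_N)) /\
                   continuous (partial i h).

Definition C2 (h : 'cV[R]_N -> R) : Prop :=
  C1 h /\ forall i : 'I_N, C1 (partial i h).

Definition set_coord (x : 'cV[R]_N) (i : 'I_N) (u : R) : 'cV[R]_N :=
  \col_j (if j == i then u else x j 0).

Definition convex_in_coord (i : 'I_N) (h : 'cV[R]_N -> R) : Prop :=
  forall x, convex_function (E := R^o) setT (fun u => h (set_coord x i u)).

Definition monotone_map (Phi : 'cV[R]_N -> 'cV[R]_N) : Prop :=
  forall x y, 0 <= dotp (Phi x - Phi y) (x - y).

Definition box (Om : 'I_N -> set R) : set 'cV[R]_N :=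
  [set x | forall i, Om i (x i 0)].

Definition VI_sol (K : set 'cV[R]_N) (Phi : 'cV[R]_N -> 'cV[R]_N)
    (x : 'cV[R]_N) : Prop :=
  K x /\ forall y, K y -> 0 <= dotp (y - x) (Phi x).

Definition pseudo_gradient (f : 'I_N -> 'cV[R]_N -> R) (x : 'cV[R]_N) :
    'cV[R]_N :=
  \col_i partial i (f i) x.

End Euclidean.

(* Projection in dimension one, where the Euclidean norm is the absolute
   value.  For K nonempty, closed and convex the minimizer exists and is
   unique; otherwise the value may be the default 0. *)
Definition proj {R : realType} (K : set R) (y : R) : R :=
  xget 0 [set z | K z /\ forall w, K w -> `|y - z| <= `|y - w|].

Section Constraint.
Context {R : realType} {N n : nat}.
Variables (A : 'M[R]_(n, N)) (b : 'cV[R]_n).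

Definition constr (x : 'cV[R]_N) : 'cV[R]_n := A *m x - b.

Definition feasible (Om : 'I_N -> set R) : set 'cV[R]_N :=
  [set x | box Om x /\ forall k, constr x k 0 <= 0].

Definition slater (Om : 'I_N -> set R) : Prop :=
  exists xint, box Om xint /\ forall k, constr xint k 0 < 0.

Definition penalty_term (k : 'I_n) (x : 'cV[R]_N) : R :=
  if constr x k 0 <= 0 then 0 else (constr x k 0) ^+ 2.

Definition penalty (x : 'cV[R]_N) : R := \sum_k penalty_term k x.

Definition variational_equilibrium (f : 'I_N -> 'cV[R]_N -> R)
    (Om : 'I_N -> set R) (x : 'cV[R]_N) : Prop :=
  VI_sol (feasible Om) (pseudo_gradient f) x.

(* the map F + d * id + e * grad P of the regularized and penalized VI *)
Definition Phi_reg (f : 'I_N -> 'cV[R]_N -> R) (d e : R) (x : 'cV[R]_N) :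
    'cV[R]_N :=
  pseudo_gradient f x + d *: x + e *: gradient penalty x.

End Constraint.

(* Calculus on [0, +oo): all derivatives are relative to the half-line, i.e.,
   two-sided at t > 0 and one-sided at t = 0, so that the values of a function
   at negative arguments are irrelevant. *)
Section HalfLine.
Context {R : realType}.
Implicit Types u : R -> R.

Definition dquot u (t : R) : R -> R := fun s => (u s - u t) / (s - t).

Definition halfline_dnbhs (t : R) : set_system R :=
  within [set s | 0 <= s] t^'.

Definition dot u (t : R) : R := lim (dquot u t @ halfline_dnbhs t).

Definition smooth_halfline u : Prop :=
  forall (k : nat) (t : R), 0 <= t ->
    cvg (dquot (iter k dot u) t @ halfline_dnbhs t).

Definition int0 u (t : R) : R :=
  \int[@lebesgue_measure R]_(s in `[0, t]) u s.

End HalfLine.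

Section Rates.
Context {R : realType}.
Variables (N : nat) (b1 b2 : R) (delta eps sig gam : R -> R).

Definition r1 (t : R) : R :=
  - (gam t) ^+ 2 *
      (N%:R * b1 ^+ 2 + N%:R * b2 ^+ 2 * (eps t) ^+ 2 + (delta t) ^+ 2)
  + 2 * gam t * delta t.

Definition r2 (t : R) : R := (`|dot delta t| + `|dot eps t|) / delta t.

Definition E_r1sig (t : R) : R := int0 (fun s => r1 s * sig s / 2) t.

Definition weighted_r2 (t : R) : R :=
  int0 (fun s => r2 s * expR (E_r1sig s)) t.

End Rates.

Definition game_dynamics {R : realType} {N n : nat}
    (A : 'M[R]_(n, N)) (b : 'cV[R]_n) (f : 'I_N -> 'cV[R]_N -> R)
    (Om : 'I_N -> set R) (delta eps sig gam : R -> R) (x : R -> 'cV[R]_N) :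
    Prop :=
  forall (t : R) (i : 'I_N), 0 <= t ->
    dquot (fun s => x s i 0) t @ halfline_dnbhs t -->
      sig t *
        (proj (Om i)
           (x t i 0 - gam t * (partial i (f i) (x t)
                               + eps t * partial i (penalty A b) (x t)
                               + delta t * x t i 0))
         - x t i 0).

(* Main.v *)
Require Import Defs.
From HB Require Import structures.
From mathcomp Require Import all_boot all_order all_algebra.
From mathcomp Require Import all_classical all_reals all_analysis.
From mathcomp Require Import ring lra.

(** Let z t be the solution of the regularized and penalized VI at time t. The
    trajectory x is shown to approach z, and z to approach the least-norm
    variational equilibrium xstar.

    For z, the penalty weight eps makes the constraint violation of z t at most
    of order eps^(-1/2), and Slater's condition turns this into a bound of the
    same order on how much xstar can lose against z t in the limit VI. Because
    delta^2 eps tends to infinity, this loss is negligible compared with the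
    Tikhonov term delta, so every cluster point of z is a variational
    equilibrium of norm at most that of xstar, hence is xstar
    ([regularized_cvg]).

    For x - z, put u t = enorm (x t - z t). The velocity of x is sig t times the
    difference between a projected step from x t and x t itself, and z t is
    fixed by the projected step. The step contracts distances to z t by the
    factor 1 - r1 / 2 ([box_proj_step], [step_contraction]). The rate r1 does not
    account for the interaction between the pseudo-gradient and the penalty
    gradient. That interaction is dominated, for t large, thanks to the
    cocoercivity of the penalty gradient ([gradient_penalty_cocoercive]) and
    because gam tends to 0 and eps to infinity ([near_contractive]). The Lipschitz
    constant b1 can be used along the whole trajectory because x moves towards
    points of the box and so stays in a ball ([relaxation_bounded]). On the other
    hand z moves with speed at most max(c_x, c_p) r2 ([VI_lipschitz]). Therefore the
    upper right Dini derivative of u is at most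
    - (r1 sig / 2) u + max(c_x, c_p) r2 for t large, and, since r2 = o(r1 sig) and
    the integral of r1 sig diverges, u tends to 0 ([decay_comparison]). *)

Import Order.TTheory GRing.Theory Num.Theory.
Import numFieldNormedType.Exports.

Set Implicit Arguments.
Unset Strict Implicit.
Unset Printing Implicit Defensive.

Local Open Scope classical_set_scope.
Local Open Scope ring_scope.

(** * Euclidean inner product and norm *)

Section Euclid.
Context {R : realType} {N : nat}.
Implicit Types x y z : 'cV[R]_N.

Lemma dotpC x y : dotp x y = dotp y x.
Proof. by apply: eq_bigr => i _; rewrite mulrC. Qed.

Lemma dotpDl x y z : dotp (x + y) z = dotp x z + dotp y z.
Proof.
by rewrite /dotp -big_split; apply: eq_bigr => i _; rewrite mxE mulrDl.
Qed.

Lemma dotpZl a x y : dotp (a *: x) y = a * dotp x y.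
Proof.
by rewrite /dotp big_distrr; apply: eq_bigr => i _; rewrite mxE /= mulrA.
Qed.

Lemma dotpNl x y : dotp (- x) y = - dotp x y.
Proof. by rewrite -scaleN1r dotpZl mulN1r. Qed.

Lemma dotpBl x y z : dotp (x - y) z = dotp x z - dotp y z.
Proof. by rewrite dotpDl dotpNl. Qed.

Lemma dotpDr x y z : dotp x (y + z) = dotp x y + dotp x z.
Proof. by rewrite dotpC dotpDl !(dotpC x). Qed.

Lemma dotpZr a x y : dotp x (a *: y) = a * dotp x y.
Proof. by rewrite dotpC dotpZl dotpC. Qed.

Lemma dotpNr x y : dotp x (- y) = - dotp x y.
Proof. by rewrite dotpC dotpNl dotpC. Qed.

Lemma dotpBr x y z : dotp x (y - z) = dotp x y - dotp x z.
Proof. by rewrite dotpDr dotpNr. Qed.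

Definition dotpE := (dotpDl, dotpDr, dotpNl, dotpNr, dotpZl, dotpZr).

Lemma dotp_ge0 x : 0 <= dotp x x.
Proof. by apply: sumr_ge0 => i _; rewrite -expr2 sqr_ge0. Qed.

Lemma dotp_sqr x : dotp x x = \sum_i x i 0 ^+ 2.
Proof. by apply: eq_bigr => i _; rewrite expr2. Qed.

Lemma dotp_eq0 x : dotp x x = 0 -> x = 0.
Proof.
move=> /eqP; rewrite dotp_sqr psumr_eq0 => [/allP h|i _]; last exact: sqr_ge0.
apply/colP => i; rewrite mxE.
by have /(_ (mem_index_enum i)) := h i; rewrite sqrf_eq0 => /eqP.
Qed.

(** Expand the nonnegative square of (y.y) x - (x.y) y. *)
Lemma CauchySchwarz_sqr x y : dotp x y ^+ 2 <= dotp x x * dotp y y.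
Proof.
have [/dotp_eq0 ->|y0] := eqVneq (dotp y y) 0.
  by rewrite -(scale0r 0) !dotpZr !mul0r mulr0 expr0n.
have yy : 0 < dotp y y by rewrite lt_def y0 dotp_ge0.
have := dotp_ge0 (dotp y y *: x - dotp x y *: y).
rewrite !dotpE (dotpC y x) => h.
have {h} : 0 <= dotp y y * (dotp x x * dotp y y - dotp x y ^+ 2) by nra.
by rewrite pmulr_rge0// subr_ge0.
Qed.

Lemma enorm_ge0 x : 0 <= enorm x. Proof. exact: sqrtr_ge0. Qed.

Lemma sqr_enorm x : enorm x ^+ 2 = dotp x x.
Proof. by rewrite sqr_sqrtr// dotp_ge0. Qed.

Lemma enorm_le x a : 0 <= a -> dotp x x <= a ^+ 2 -> enorm x <= a.
Proof.
by move=> a0 xa; rewrite -(@ler_pXn2r _ 2)// ?nnegrE ?enorm_ge0// sqr_enorm.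
Qed.

Lemma CauchySchwarz x y : dotp x y <= enorm x * enorm y.
Proof.
apply: le_trans (ler_norm _) _.
rewrite -(@ler_pXn2r _ 2)// ?nnegrE ?mulr_ge0 ?enorm_ge0//.
by rewrite exprMn !sqr_enorm real_normK ?num_real// CauchySchwarz_sqr.
Qed.

Lemma enormD x y : enorm (x + y) <= enorm x + enorm y.
Proof.
apply: enorm_le; first by rewrite addr_ge0 ?enorm_ge0.
have := CauchySchwarz x y.
by rewrite sqrrD !sqr_enorm !dotpE (dotpC y x); lra.
Qed.

Lemma enormZ a x : enorm (a *: x) = `|a| * enorm x.
Proof.
by rewrite /enorm dotpZl dotpZr mulrA -expr2 sqrtrM ?sqr_ge0// sqrtr_sqr.
Qed.

Lemma enormN x : enorm (- x) = enorm x.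
Proof. by rewrite -scaleN1r enormZ normrN1 mul1r. Qed.

Lemma enorm_triangle y x z : enorm (x - z) <= enorm (x - y) + enorm (y - z).
Proof. by have := enormD (x - y) (y - z); rewrite subrKA. Qed.

Lemma coord_le_enorm x i : `|x i 0| <= enorm x.
Proof.
rewrite -(@ler_pXn2r _ 2)// ?nnegrE ?enorm_ge0// real_normK ?num_real//.
rewrite sqr_enorm dotp_sqr (bigD1 i)//= lerDl.
by apply: sumr_ge0 => j _; exact: sqr_ge0.
Qed.

Lemma enorm_le_sum x : enorm x <= \sum_i `|x i 0|.
Proof.
have S0 : 0 <= \sum_i `|x i 0| by apply: sumr_ge0.
apply: enorm_le => //; rewrite dotp_sqr expr2 big_distrl ler_sum//= => i _.
rewrite -real_normK ?num_real// expr2 ler_wpM2l// (bigD1 i)//= lerDl.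
by apply: sumr_ge0.
Qed.

Lemma normr_le_enorm x : `|x| <= enorm x.
Proof.
rewrite [`|x|]/Num.Def.normr/= mx_normrE; apply/bigmax_leP; split.
  exact: enorm_ge0.
by case=> i j _; rewrite /= (ord1 j) coord_le_enorm.
Qed.

Lemma cvg_coord (T : Type) (F : set_system T) (f : T -> 'cV[R]_N)
    (a : 'cV[R]_N) i {FF : Filter F} :
  f @ F --> a -> (f t i 0) @[t --> F] --> a i 0.
Proof.
move=> fa; apply: (@cvg_comp _ _ _ f (fun M : 'cV[R]_N => M i 0) _ _ _ fa).
exact: coord_continuous.
Qed.

Lemma cvg_dotp (T : Type) (F : set_system T) (f g : T -> 'cV[R]_N)
    (a b : 'cV[R]_N) {FF : Filter F} : f @ F --> a -> g @ F --> b ->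
  dotp (f t) (g t) @[t --> F] --> dotp a b.
Proof.
move=> fa gb; apply: cvg_big => [|i _]; first exact: add_continuous.
by apply: cvgM; exact: cvg_coord.
Qed.

Lemma cvg_colP (T : Type) (F : set_system T) (f : T -> 'cV[R]_N) (a : 'cV[R]_N)
    {FF : Filter F} : (forall i, (f t i 0) @[t --> F] --> a i 0) -> f @ F --> a.
Proof.
move=> h; apply/cvg_ballP => e e0; near=> t; split => // i j.
rewrite (ord1 j); move: i; near: t; apply: filter_forall => i.
by move: (h i) => /cvg_ballP; apply.
Unshelve. all: by end_near. Qed.

End Euclid.

(** * Projection onto intervals and the quadratic penalty *)

Section Projection.
Context {R : realType}.
Implicit Types (K : set R) (y z w : R).

Lemma convex_set_segment K a b t : convex_set (M := R^o) K ->
  K a -> K b -> 0 <= t -> t <= 1 -> K (t * a + (1 - t) * b).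
Proof.
move=> cK /mem_set Ka /mem_set Kb t0 t1.
have /set_mem := cK a b (Itv01 t0 t1) Ka Kb.
exact: id.
Qed.

Lemma projP K y : K !=set0 -> compact K ->
  K (Defs.proj K y) /\ forall w, K w -> `|y - Defs.proj K y| <= `|y - w|.
Proof.
move=> K0 cK.
have [|c /set_mem Kc cmin] :=
    @compact_EVT_min _ _ (fun z => `|y - z|) K K0 cK.
  apply: continuous_subspaceT => z; apply: cvg_norm.
  by apply: cvgB; [exact: cvg_cst|exact: cvg_id].
rewrite /Defs.proj; case: xgetP => [z -> []|/(_ c)] //.
by case; split => // w Kw; apply: cmin; rewrite inE.
Qed.

(** The obtuse-angle characterization of the projection. Moving from the
    projection p towards w by a fraction t changes the squared distance to y
    by t (2 (p - y)(w - p) + t (w - p)^2), which minimality keeps nonnegative;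
    a negative inner product is excluded by a suitable t in [0, 1]. *)
Lemma proj_obtuse K y w : K !=set0 -> convex_set (M := R^o) K -> compact K ->
  K w -> 0 <= (Defs.proj K y - y) * (w - Defs.proj K y).
Proof.
move=> K0 convK cK Kw; have [Kp pmin] := projP y K0 cK.
set p := Defs.proj K y in Kp pmin *.
have quad t : 0 <= t -> t <= 1 ->
    0 <= t * (2 * ((p - y) * (w - p)) + t * (w - p) ^+ 2).
  move=> t0 t1.
  have := pmin _ (@convex_set_segment K w p t convK Kw Kp t0 t1).
  rewrite -(@ler_pXn2r _ 2)// ?nnegrE// !real_normK ?num_real//.
  by nra.
rewrite leNgt; apply/negP => neg.
have [|w2] := leP ((w - p) ^+ 2) (- ((p - y) * (w - p))).
  by move=> h; have := quad 1 ler01 (lexx _); nra.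
(* the minimizer over t of the quadratic in quad *)
set t := - ((p - y) * (w - p)) / (w - p) ^+ 2.
have W : 0 < (w - p) ^+ 2 by lra.
have t0 : 0 < t by rewrite divr_gt0// oppr_gt0.
have t1 : t <= 1 by rewrite ler_pdivrMr// mul1r ltW.
have := quad t (ltW t0) t1.
rewrite pmulr_rge0// divfK ?gt_eqF//; lra.
Qed.

(** The hypothesis on z says that z is the projection of y'. Stating it as a
    variational inequality lets the solution of a VI be compared directly with
    a projected step. The proof adds the obtuse-angle inequalities at the two
    projections. *)
Lemma proj_nonexpansive K y y' z : K !=set0 -> convex_set (M := R^o) K ->
  compact K -> K z -> (forall w, K w -> 0 <= (z - y') * (w - z)) ->
  (Defs.proj K y - z) ^+ 2 <= (y - y') ^+ 2.
Proof.
move=> K0 convK cK Kz zP.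
have := zP _ (projP y K0 cK).1; have := @proj_obtuse K y z K0 convK cK Kz.
set p := Defs.proj K y => h1 h2.
have : 0 <= (p - z) * ((y - y') - (p - z)) by lra.
by have := sqr_ge0 ((y - y') - (p - z)); nra.
Qed.

End Projection.

Section PositivePart.
Context {R : realType}.
Implicit Types s t : R.

Definition pos s : R := Num.max 0 s.

Lemma pos_ge s : s <= pos s. Proof. by rewrite le_max lexx orbT. Qed.

Lemma pos_sqr_convex s t : pos s ^+ 2 + 2 * pos s * (t - s) <= pos t ^+ 2.
Proof.
have := sqr_ge0 (t - s).
by rewrite /pos; case: (leP 0 s) => hs; case: (leP 0 t) => ht; nra.
Qed.

Lemma pos_sqr_smooth s t :
  pos t ^+ 2 <= pos s ^+ 2 + 2 * pos s * (t - s) + (t - s) ^+ 2.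
Proof.
have := sqr_ge0 (t - s).
by rewrite /pos; case: (leP 0 s) => hs; case: (leP 0 t) => ht; nra.
Qed.

(** The positive part is firmly nonexpansive; this is where the cocoercivity
    of the penalty gradient comes from. *)
Lemma pos_firm s t : (pos s - pos t) ^+ 2 <= (pos s - pos t) * (s - t).
Proof.
have := sqr_ge0 (t - s).
by rewrite /pos; case: (leP 0 s) => hs; case: (leP 0 t) => ht; nra.
Qed.

End PositivePart.

Section Penalty.
Context {R : realType} {N n : nat}.
Variables (A : 'M[R]_(n, N)) (b : 'cV[R]_n).
Implicit Types x y z w : 'cV[R]_N.

Definition viol x : 'cV[R]_n := \col_k pos (constr A b x k 0).

Lemma violE x k : viol x k 0 = pos (constr A b x k 0).
Proof. by rewrite mxE. Qed.

Lemma penaltyE x : penalty A b x = dotp (viol x) (viol x).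
Proof.
rewrite dotp_sqr; apply: eq_bigr => k _; rewrite mxE /penalty_term /pos.
by case: (leP 0 (constr A b x k 0)) => h; case: (leP (constr A b x k 0) 0);
  nra.
Qed.

Lemma penalty_ge0 x : 0 <= penalty A b x.
Proof. by rewrite penaltyE dotp_ge0. Qed.

Lemma constrB x y k :
  constr A b x k 0 - constr A b y k 0 = (A *m (x - y)) k 0.
Proof. by rewrite /constr mulmxBr !mxE; ring. Qed.

(** A remainder quadratic in the step identifies the directional derivative;
    it suits the penalty, which is not twice differentiable. *)
Lemma derive_second_order (f : 'cV[R]_N -> R) x v l C :
  (forall h : R, `|f (h *: v + x) - f x - h * l| <= C * h ^+ 2) ->
  'D_v f x = l.
Proof.
move=> fC; apply: cvg_lim => //; apply/cvgrPdist_le => /= e e0.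
have C1 : 0 < `|C| + 1 by rewrite ltr_wpDl.
near=> h.
have h0 : h != 0 by near: h; exact: nbhs_dnbhs_neq.
have hn : 0 < `|h| by rewrite normr_gt0.
have -> : l - h^-1 *: (f (h *: v + x) - f x) =
    - (h^-1 * (f (h *: v + x) - f x - h * l)).
  by rewrite /GRing.scale/=; field.
rewrite normrN normrM normfV ler_pdivrMl//.
apply: (le_trans (fC h)); rewrite -real_normK ?num_real//.
have : `|h| <= e / (`|C| + 1) by near: h; apply: dnbhs0_le; exact: divr_gt0.
rewrite ler_pdivlMr// => hh.
by have := ler_norm C; nra.
Unshelve. all: by end_near. Qed.

Lemma partial_penalty i x :
  partial i (penalty A b) x = 2 * dotp (viol x) (col i A).
Proof.
apply: (@derive_second_order _ _ _ _ (\sum_k (A k i) ^+ 2)) => h.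
set y := _ + x.
have step k : constr A b y k 0 - constr A b x k 0 = h * A k i.
  rewrite constrB /y addrK -scalemxAr mxE; congr (_ * _).
  rewrite mxE (bigD1 i)//= mxE !eqxx mulr1 big1 ?addr0// => j ji.
  by rewrite mxE (negbTE ji) mulr0.
have -> : penalty A b y - penalty A b x - h * (2 * dotp (viol x) (col i A)) =
    \sum_k (viol y k 0 ^+ 2 - viol x k 0 ^+ 2 - h * (2 * (viol x k 0 * A k i))).
  rewrite !penaltyE !dotp_sqr /dotp !big_distrr -!sumrB /=.
  by apply: eq_bigr => k _; rewrite [col i A k 0]mxE.
apply: le_trans (ler_norm_sum _ _ _) _.
rewrite big_distrl ler_sum//= => k _; rewrite !violE.
set s := constr A b x k 0; set t := constr A b y k 0.
have st : t - s = h * A k i by exact: step.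
have := pos_sqr_convex s t; have := pos_sqr_smooth s t; rewrite st => h1 h2.
have h3 := sqr_ge0 (h * A k i).
by rewrite ler_norml; apply/andP; split; lra.
Qed.

Lemma gradient_penalty x : gradient (penalty A b) x = 2 *: (A^T *m viol x).
Proof.
apply/colP => i; rewrite !mxE partial_penalty; congr (_ * _).
by apply: eq_bigr => k _; rewrite !mxE mulrC.
Qed.

Lemma dotp_mulmxTl (u : 'cV[R]_n) x : dotp (A^T *m u) x = dotp u (A *m x).
Proof.
rewrite /dotp; under eq_bigr do rewrite mxE big_distrl.
under [RHS]eq_bigr do rewrite mxE big_distrr.
rewrite exchange_big; apply: eq_bigr => k _; apply: eq_bigr => i _.
by rewrite mxE /=; ring.
Qed.

(** The gradient inequality of a convex function, summed from the scalar
    inequality for the squared positive part of each constraint. *)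
Lemma penalty_convex x y :
  penalty A b x + dotp (gradient (penalty A b) x) (y - x) <= penalty A b y.
Proof.
rewrite gradient_penalty dotpZl dotp_mulmxTl !penaltyE !dotp_sqr.
rewrite /dotp big_distrr -big_split ler_sum//= => k _.
by rewrite -constrB !violE mulrA; exact: pos_sqr_convex.
Qed.

(** The gradient is 2 A^T (g(x))_+, so firm nonexpansiveness of the positive
    part bounds the inner product below by twice the squared variation of the
    violations, and the latter controls the variation of the gradient through
    the Frobenius norm of A, whose square is F below. *)
Lemma gradient_penalty_cocoercive : exists2 kappa : R, 0 < kappa &
  forall x y, let G := gradient (penalty A b) in
    kappa * dotp (G x - G y) (G x - G y) <= dotp (G x - G y) (x - y).
Proof.
pose F := \sum_i dotp (col i A) (col i A).
have F0 : 0 <= F by apply: sumr_ge0 => i _; exact: dotp_ge0.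
exists (2 * F + 1)^-1 => [|x y /=]; first by rewrite invr_gt0; lra.
rewrite !gradient_penalty -scalerBr -mulmxBr; set s := viol x - viol y.
rewrite !dotpZl dotpZr [dotp _ (x - y)]dotp_mulmxTl.
rewrite ler_pdivrMl; last by lra.
have firm : dotp s s <= dotp s (A *m (x - y)).
  rewrite dotp_sqr ler_sum// => k _; rewrite -constrB 2!mxE [X in _ + X]mxE !violE.
  exact: pos_firm.
have : dotp (A^T *m s) (A^T *m s) <= F * dotp s s.
  rewrite dotp_sqr big_distrl ler_sum//= => i _.
  apply: le_trans (CauchySchwarz_sqr _ _).
  by rewrite mxE /dotp; under eq_bigr do rewrite !mxE;
    under [in leRHS]eq_bigr do rewrite !mxE.
move: firm (dotp_ge0 s).
set S := dotp s s; set Y := dotp s _; set X := dotp _ _.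
move=> SY S0 XS; have := mulr_ge0 F0 (_ : 0 <= Y - S).
by rewrite subr_ge0 => /(_ SY); lra.
Qed.

Lemma penalty_feasible Om x : feasible A b Om x -> penalty A b x = 0.
Proof.
by move=> [_ gx]; apply: big1 => k _; rewrite /penalty_term gx.
Qed.

End Penalty.

(** * Convergence of the regularized solutions *)

Section Cluster.

(** If F avoided a neighbourhood U of p, the trace of F on the complement of
    U would cluster in V; that cluster point would be p, contradicting U. *)
Lemma compact_cluster_cvg (T : topologicalType) (V : set T)
    (F : set_system T) (p : T) {FF : ProperFilter F} :
  compact V -> F V -> cluster F `<=` [set p] -> F --> p.
Proof.
move=> cV FV clF U Up; apply: contrapT => nFU.
pose G := within (~` U) F.
have GP : ProperFilter G.
  apply: Build_ProperFilter; rewrite /G /within/=.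
  by apply: contra_not nFU; apply: filterS => q; exact: contrapT.
have [|c [_ clc]] := cV G GP; first by apply: filterS FV.
have cp : c = p.
  by apply: clF => A B FA; apply: clc; apply: filterS FA.
have GU : G (~` U) by rewrite /G /within/=; exact: nearW.
by rewrite -cp in Up; have [q []] := clc _ _ GU Up.
Qed.

(** Asymptotic inequalities along a filter pass to its cluster points. *)
Lemma cluster_ge0 (R : realType) (S : Type) (T : topologicalType)
    (G : set_system S) (z : S -> T) (c : T) (h : T -> R) {FG : Filter G} :
  cluster (z @ G) c -> h @ c --> h c ->
  (forall e, 0 < e -> \forall t \near G, - e <= h (z t)) -> 0 <= h c.
Proof.
move=> clc ch hz; apply/ler_addgt0Pr => e e0.
have e2 : 0 < e / 2 by rewrite divr_gt0.
have /cvgrPdist_le/(_ _ e2) nc := ch.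
have [|q [/= h1 h2]] := clc [set q | - (e / 2) <= h q] _ _ nc.
  exact: hz.
by move: h2; rewrite ler_norml => /andP[]; lra.
Qed.

End Cluster.

Section VariationalInequality.
Context {R : realType} {N : nat}.
Implicit Types (w x y z : 'cV[R]_N) (K : set 'cV[R]_N)
  (Psi : 'cV[R]_N -> 'cV[R]_N).

Lemma cvg_subr y x : (fun z => y - z) @ x --> y - x.
Proof.
by apply: (@cvgB R 'cV[R]_N _ (nbhs x)); [exact: cvg_cst|exact: cvg_id].
Qed.

Lemma cvg_dotp_subr y w x : dotp (y - z) w @[z --> x] --> dotp (y - x) w.
Proof.
exact: (@cvg_dotp _ _ _ (nbhs x) (fun z => y - z) (cst w) _ _ _
  (@cvg_subr y x) (cvg_cst _)).
Qed.

Lemma cvg_dotp_subr_id y x : dotp (y - z) z @[z --> x] --> dotp (y - x) x.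
Proof.
exact: (@cvg_dotp _ _ _ (nbhs x) (fun z => y - z) id _ _ _
  (@cvg_subr y x) cvg_id).
Qed.

Lemma box_compact (Om : 'I_N -> set R) :
  (forall i, compact (Om i)) -> compact (box Om).
Proof.
move=> cOm.
have -> : box Om = trmx @` [set v : 'rV[R]_N | forall i, Om i (v 0 i)].
  apply/seteqP; split => [x xOm|_ [v vOm <-] i]; last by rewrite mxE; exact: vOm.
  by exists x^T => [i|]; rewrite ?trmxK// mxE; exact: xOm.
apply: continuous_compact; last exact: rV_compact.
apply: continuous_subspaceT => v.
apply: (@cvg_colP _ _ _ (nbhs v)) => i.
under eq_fun do rewrite mxE; rewrite mxE.
exact: coord_continuous.
Qed.

Definition convex K := forall x y (t : R), K x -> K y -> 0 <= t -> t <= 1 ->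
  K (t *: x + (1 - t) *: y).

Lemma box_convex (Om : 'I_N -> set R) :
  (forall i, convex_set (M := R^o) (Om i)) -> convex (box Om).
Proof.
move=> cOm x y t xO yO t0 t1 i; rewrite !mxE.
exact: convex_set_segment.
Qed.

(** Minty's lemma: test the inequality at x + t (y - x), divide by t and let
    t decrease to 0. *)
Lemma minty K Psi x : convex K -> continuous Psi -> K x ->
  (forall y, K y -> 0 <= dotp (y - x) (Psi y)) -> VI_sol K Psi x.
Proof.
move=> convK cPsi Kx xP; split=> // y Ky.
pose p (t : R) := t *: y + (1 - t) *: x.
have cp : p @ (0 : R)^'+ --> x.
  have -> : x = 0 *: y + (1 - 0) *: x by rewrite scale0r add0r subr0 scale1r.
  apply: cvg_at_right_filter; apply: cvgD; apply: cvgZr_tmp; first exact: cvg_id.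
  by apply: cvgB; [exact: cvg_cst|exact: cvg_id].
have cd : dotp (y - x) (Psi (p t)) @[t --> (0 : R)^'+] --> dotp (y - x) (Psi x).
  apply: cvg_dotp; first exact: cvg_cst.
  by apply: (cvg_comp _ _ cp); exact: cPsi.
apply: (@cvgr_to_ge _ _ _ _ _ _ _ cd).
near=> t.
have t0 : 0 < t by near: t; exact: nbhs_right_gt.
have t1 : t <= 1 by near: t; exact: nbhs_right_le.
have := xP _ (convK y x t Ky Kx (ltW t0) t1).
have -> : t *: y + (1 - t) *: x - x = t *: (y - x).
  by apply/colP => i; rewrite !mxE; ring.
by rewrite dotpZl pmulr_rge0.
Unshelve. all: by end_near. Qed.

End VariationalInequality.

Section RegularizedSolutions.
Context {R : realType} {N n : nat}.
Variables (A : 'M[R]_(n, N)) (b : 'cV[R]_n) (Om : 'I_N -> set R).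
Variable Psi : 'cV[R]_N -> 'cV[R]_N.
Implicit Types x y z : 'cV[R]_N.
Hypothesis Om_convex : forall i, convex_set (M := R^o) (Om i).
Hypothesis Om_compact : forall i, compact (Om i).
Hypothesis Om_slater : slater A b Om.
Hypothesis Psi_monotone : monotone_map Psi.
Hypothesis Psi_continuous : continuous Psi.

Let P := penalty A b.
Let Q := feasible A b Om.

Lemma constr_affine x y t k :
  constr A b (t *: x + (1 - t) *: y) k 0 =
  t * constr A b x k 0 + (1 - t) * constr A b y k 0.
Proof. by rewrite /constr mulmxDr -!scalemxAr !mxE; ring. Qed.

Lemma cvg_constr k x : constr A b y k 0 @[y --> x] --> constr A b x k 0.
Proof.
have rowE y : constr A b y k 0 = dotp (row k A)^T y - b k 0.
  by rewrite /constr 3!mxE; congr (_ - _); apply: eq_bigr => j _; rewrite !mxE.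
under eq_fun do rewrite rowE; rewrite rowE.
have FF := @nbhs_filter _ x.
have h := @cvg_dotp _ _ _ (nbhs x) (cst (row k A)^T) id _ _ FF (cvg_cst _) cvg_id.
by apply: cvgB; [exact: h|exact: cvg_cst].
Qed.

Lemma feasible_convex : convex Q.
Proof.
move=> x y t [xO gx] [yO gy] t0 t1; split; first exact: box_convex.
move=> k; rewrite constr_affine.
by have := gx k; have := gy k; nra.
Qed.

Lemma constr_le_viol x k : constr A b x k 0 <= enorm (viol A b x).
Proof.
apply: le_trans (coord_le_enorm _ k); rewrite violE.
by apply: le_trans (pos_ge _) _; exact: ler_norm.
Qed.

(** At a point z of the box that violates the constraints by at most v, moving
    towards the Slater point by the fraction v / (v + s), with s the Slater
    margin, restores feasibility. The solution y of the VI beats that feasible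
    point w, and w differs from z by O(v), so y can lose against z only by
    O(v). *)
Lemma slater_bound y C : (forall x, box Om x -> enorm x <= C) ->
  VI_sol Q Psi y -> exists2 L, 0 <= L &
  forall z, box Om z -> dotp (y - z) (Psi y) <= L * enorm (viol A b z).
Proof.
move=> bC [Qy yVI]; have [xi [xiO gxi]] := Om_slater.
have /filter_ex[s [s0 sg]] : \forall s \near (0 : R)^'+,
    0 < s /\ forall k, s <= - constr A b xi k 0.
  near=> s; split; first by near: s; exact: nbhs_right_gt.
  near: s; apply: filter_forall => k; apply: nbhs_right_le.
  by rewrite oppr_gt0; exact: gxi.
pose M := (enorm xi + C) * enorm (Psi y).
have C0 : 0 <= C by apply: le_trans (bC _ xiO); exact: enorm_ge0.
have M0 : 0 <= M by rewrite mulr_ge0 ?addr_ge0 ?enorm_ge0.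
exists (M / s) => [|z zO]; first by rewrite divr_ge0// ltW.
set v := enorm (viol A b z); have v0 : 0 <= v by exact: enorm_ge0.
pose t := v / (v + s).
have vs : 0 < v + s by lra.
have t0 : 0 <= t by rewrite divr_ge0// ltW.
have t1 : t <= 1 by rewrite ler_pdivrMr// mul1r; lra.
have tE : t * (v + s) = v by rewrite divfK// gt_eqF.
pose w := t *: xi + (1 - t) *: z.
have Qw : Q w.
  split=> [|k]; first exact: box_convex.
  rewrite constr_affine.
  by have := constr_le_viol z k; have := sg k; rewrite -/v; nra.
have -> : y - z = t *: (xi - z) - (w - y).
  by apply/colP => i; rewrite !mxE; ring.
rewrite dotpBl dotpZl.
have := yVI _ Qw.
have : dotp (xi - z) (Psi y) <= M.
  apply: le_trans (CauchySchwarz _ _) _; apply: ler_wpM2r; first exact: enorm_ge0.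
  by apply: le_trans (enormD _ _) _; rewrite enormN lerD2l; exact: bC.
have : t <= v / s.
  by rewrite ler_pdivlMr//; nra.
move=> h1 h2 h3.
have : t * dotp (xi - z) (Psi y) <= t * M by rewrite ler_wpM2l.
have : t * M <= v / s * M by rewrite ler_wpM2r.
by lra.
Unshelve. all: by end_near. Qed.

(** Test the regularized VI at a feasible y. Convexity and P y = 0 bound the
    penalty term by - e * P z, and monotonicity moves Psi from z to y. *)
Lemma regularized_VI d e y z : Q y ->
  VI_sol (box Om) (fun x => Psi x + d *: x + e *: gradient P x) z ->
  0 <= e -> e * P z <= dotp (y - z) (Psi y) + d * dotp (y - z) z.
Proof.
move=> Qy [zO zVI] e0; have := zVI y Qy.1; rewrite !dotpDr !dotpZr.
have := penalty_convex A b z y; rewrite (penalty_feasible Qy) -/P dotpC.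
have := Psi_monotone y z; rewrite dotpC dotpBr.
by nra.
Qed.

(** The regularized solutions stay in a compact box, so it suffices to identify
    their cluster points. By [regularized_VI] the penalty at z is O(1 / e), so
    the violation of the constraints is o(d) because d^2 e tends to infinity.
    Hence a cluster point c is feasible, and Minty's lemma makes it a solution
    of the limit VI. Dividing [regularized_VI] at y = xs by d and using
    [slater_bound] gives (xs - c).c >= 0, because the violation divided by d
    tends to 0. Thus |xs - c|^2 <= |xs|^2 - |c|^2, and the right-hand side is
    nonpositive as xs has the least norm. *)
Lemma regularized_cvg (S : Type) (G : set_system S) (z : S -> 'cV[R]_N)
    (d e : S -> R) xs C {FG : ProperFilter G} :
  (forall x, box Om x -> enorm x <= C) ->
  (\forall t \near G, [/\ 0 < d t, 0 < e t & VI_sol (box Om)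
     (fun x => Psi x + d t *: x + e t *: gradient P x) (z t)]) ->
  d @ G --> (0 : R) -> d t ^+ 2 * e t @[t --> G] --> +oo%R ->
  VI_sol Q Psi xs -> (forall y, VI_sol Q Psi y -> enorm xs <= enorm y) ->
  z @ G --> xs.
Proof.
move=> bC zsol d0 de xsol xleast.
have C0 : 0 <= C by apply: le_trans (bC _ xsol.1.1); exact: enorm_ge0.
have [L L0 xL] := slater_bound bC xsol.
have Qxs := xsol.1.
pose D := 2 * C * enorm (Psi xs) + 2 * C * C.
have D0 : 0 <= D by rewrite addr_ge0 ?mulr_ge0 ?enorm_ge0.
(* D bounds e times the squared violation, see regularized_VI *)
have small eta : 0 < eta -> \forall t \near G,
    enorm (viol A b (z t)) <= eta * d t /\ d t <= Num.min 1 eta.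
  move=> eta0; have m0 : 0 < Num.min 1 eta by rewrite lt_min ltr01 eta0.
  near=> t.
  have [dt et zt] : [/\ 0 < d t, 0 < e t & VI_sol (box Om)
     (fun x => Psi x + d t *: x + e t *: gradient P x) (z t)] by near: t.
  have dm : d t <= Num.min 1 eta.
    near: t; move/cvgrPdist_le : d0 => /(_ _ m0).
    by apply: filterS => t; rewrite sub0r normrN; apply: le_trans (ler_norm _).
  split => //; have d1 : d t <= 1 by move: dm; rewrite le_min => /andP[].
  have deD : D / eta ^+ 2 <= d t ^+ 2 * e t.
    by near: t; move/cvgryPge : de; apply.
  move: deD; rewrite ler_pdivrMr ?exprn_gt0// => deD.
  have h := regularized_VI Qxs zt (ltW et).
  have [zO _] := zt; have zC := bC _ zO; have xC := bC _ Qxs.1.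
  have xz : enorm (xs - z t) <= 2 * C.
    by apply: le_trans (enormD _ _) _; rewrite enormN; lra.
  have h1 : dotp (xs - z t) (Psi xs) <= 2 * C * enorm (Psi xs).
    by apply: le_trans (CauchySchwarz _ _) _; rewrite ler_wpM2r ?enorm_ge0.
  have h2 : dotp (xs - z t) (z t) <= 2 * C * C.
    by apply: le_trans (CauchySchwarz _ _) _; rewrite ler_pM ?enorm_ge0.
  have h3 : d t * dotp (xs - z t) (z t) <= 2 * C * C.
    apply: (@le_trans _ _ (d t * (2 * C * C))); first by rewrite ler_wpM2l// ltW.
    by rewrite ler_piMl// mulr_ge0// mulr_ge0.
  rewrite -(@ler_pXn2r _ 2)// ?nnegrE ?enorm_ge0 ?mulr_ge0 ?(ltW eta0) ?(ltW dt)//.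
  rewrite sqr_enorm -penaltyE -/P -(ler_pM2l et) exprMn.
  by move: h h1 h3 deD; rewrite /D; lra.
apply: (compact_cluster_cvg (box_compact Om_compact)).
  by apply: filterS zsol => t [_ _ []].
move=> c clc; rewrite /=.
have cO : box Om c.
  have /compact_closed := box_compact Om_compact.
  move=> /(_ (@norm_hausdorff _ _)); apply.
  move: clc; rewrite clusterE; apply.
  by apply: filterS zsol => t [_ _ []].
have Qc : Q c.
  split=> // k; rewrite -oppr_ge0.
  apply: (cluster_ge0 (h := fun x => - constr A b x k 0) clc) => [|eta eta0].
    apply: (@cvgN R R^o _ (nbhs c)); exact: cvg_constr.
  apply: filterS (small eta eta0) => t [h1 h2].
  rewrite lerN2; apply: le_trans (constr_le_viol _ _) (le_trans h1 _).
  by move: h2; rewrite le_min => /andP[]; nra.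
have cVI : VI_sol Q Psi c.
  apply: minty => // [|y Qy]; first exact: feasible_convex.
  apply: (cluster_ge0 (h := fun x => dotp (y - x) (Psi y)) clc) => [|eta eta0].
    exact: cvg_dotp_subr.
  have eta1 : 0 < eta / (2 * C * C + 1).
    by rewrite divr_gt0// ltr_wpDl// !mulr_ge0.
  apply: filterS2 zsol (small _ eta1) => t [dt et zt] [_ h2].
  have h := regularized_VI Qy zt (ltW et).
  have [zO _] := zt; have zC := bC _ zO; have yC := bC _ Qy.1.
  have yz : enorm (y - z t) <= 2 * C.
    by apply: le_trans (enormD _ _) _; rewrite enormN; lra.
  have h3 : dotp (y - z t) (z t) <= 2 * C * C.
    by apply: le_trans (CauchySchwarz _ _) _; rewrite ler_pM ?enorm_ge0.
  have h4 : 0 <= e t * P (z t) by rewrite mulr_ge0 ?penalty_ge0 ?ltW.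
  have h5 : d t * (2 * C * C + 1) <= eta.
    rewrite -ler_pdivlMr ?ltr_wpDl ?mulr_ge0//.
    by move: h2; rewrite le_min => /andP[].
  have h6 : d t * dotp (y - z t) (z t) <= d t * (2 * C * C) by rewrite ler_wpM2l// ltW.
  by lra.
have cx : 0 <= dotp (xs - c) c.
  apply: (cluster_ge0 (h := fun x => dotp (xs - x) x) clc) => [|eta eta0].
    exact: cvg_dotp_subr_id.
  have eta1 : 0 < eta / (L + 1) by rewrite divr_gt0// ltr_wpDl.
  apply: filterS2 zsol (small _ eta1) => t [dt et zt] [h1 _].
  have h := regularized_VI Qxs zt (ltW et).
  have h4 : 0 <= e t * P (z t) by rewrite mulr_ge0 ?penalty_ge0 ?ltW.
  have h5 := xL _ zt.1.
  rewrite -(ler_pM2l dt).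
  have h6 : L * enorm (viol A b (z t)) <= L * (eta / (L + 1) * d t) by rewrite ler_wpM2l.
  have h7 : L * (eta / (L + 1) * d t) <= eta * d t.
    rewrite mulrA ler_wpM2r ?(ltW dt)// mulrCA ler_piMr ?(ltW eta0)//.
    by rewrite ler_pdivrMr ?ltr_wpDl// mul1r lerDl.
  by lra.
have xc := xleast _ cVI.
apply/esym/eqP; rewrite -subr_eq0; apply/eqP/dotp_eq0/le_anti.
rewrite dotp_ge0 andbT.
have : enorm xs ^+ 2 <= enorm c ^+ 2 by rewrite ler_pXn2r ?nnegrE ?enorm_ge0.
by move: cx; rewrite !sqr_enorm !dotpE (dotpC c xs); lra.
Unshelve. all: by end_near. Qed.

End RegularizedSolutions.

(** * Dini monotonicity and calculus on the half-line *)

Section Dini.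
Context {R : realType}.
Implicit Types (v : R -> R) (s t T : R).

Lemma at_right_interval t (P : R -> Prop) : (\forall s \near t^'+, P s) ->
  exists2 d, 0 < d & forall s, t < s -> s <= t + d -> P s.
Proof.
move=> /nbhs_ballP[d /= d0 dP]; exists (d / 2); first by rewrite divr_gt0.
move=> s ts sd; apply: dP => //=; rewrite /ball/= ltr_norml; apply/andP; split; lra.
Qed.

(** A Dini-derivative criterion for monotonicity, used because the solution
    path of the regularized VIs is only locally Lipschitz. For each slope e > 0
    the largest time up to which v stays below the line of slope e through
    (T, v T) is attained by left continuity and, by the right-hand estimate,
    cannot lie before b. *)
Lemma dini_nonincreasing v T :
  (forall t, T < t -> v @ t^'- --> v t) ->
  (forall t e, T <= t -> 0 < e ->
     \forall s \near t^'+, v s <= v t + e * (s - t)) ->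
  forall t, T <= t -> v t <= v T.
Proof.
move=> vleft vdini b Tb; apply/ler_addgt0Pr => e0 e0_gt0.
pose e := e0 / (b - T + 1).
have bT1 : 0 < b - T + 1 by lra.
have e_gt0 : 0 < e by rewrite divr_gt0.
suff ub : v b <= v T + e * (b - T).
  apply: (le_trans ub); rewrite lerD2l /e mulrAC ler_pdivrMr// ler_wpM2l ?(ltW e0_gt0)//.
  by lra.
pose good t := forall s, T <= s -> s <= t -> v s <= v T + e * (s - T).
pose S := [set t | [/\ T <= t, t <= b & good t]].
have ST : S T.
  split=> // s Ts sT; have -> : s = T by apply: le_anti; rewrite sT.
  by rewrite subrr mulr0 addr0.
have Sb : ubound S b by move=> t [].
have hasS : has_sup S by split; [exists T|exists b].
set m := sup S.
have Tm : T <= m by apply: sup_upper_bound.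
have mb : m <= b by apply: ge_sup => //; exists T.
have below s : T <= s -> s < m -> v s <= v T + e * (s - T).
  move=> Ts sm; have ms0 : 0 < m - s by lra.
  have [t [_ _ gt] mt] := sup_adherent ms0 hasS.
  by apply: gt => //; move: mt; rewrite -/m; lra.
have gm : good m.
  move=> s Ts; rewrite le_eqVlt => /predU1P[->{s Ts}|]; last exact: below.
  move: Tm; rewrite le_eqVlt => /predU1P[<-|Tm]; first by rewrite subrr mulr0 addr0.
  apply: (@cvgr_to_le _ _ _ _ _ _ _ (vleft m Tm)).
  near=> s.
  have sm : s < m by near: s; exact: nbhs_left_lt.
  have Ts : T < s by near: s; exact: nbhs_left_gt.
  apply: le_trans (below _ (ltW Ts) sm) _.
  by rewrite lerD2l ler_wpM2l ?(ltW e_gt0)//; lra.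
move: mb; rewrite le_eqVlt => /predU1P[<-|mb]; first by apply: gm.
have [d d0 dP] := at_right_interval (vdini m e Tm e_gt0).
pose m' := Num.min (m + d) b.
have mm' : m < m' by rewrite lt_min mb andbT; lra.
suff : m' <= m by rewrite leNgt mm'.
apply: sup_upper_bound => //; split; first by lra.
  by rewrite ge_min lexx orbT.
move=> s Ts sm'; have [sm|ms] := leP s m; first exact: gm.
have := dP _ ms; have : s <= m + d by move: sm'; rewrite le_min => /andP[].
by move=> h /(_ h); have := gm m Tm (lexx _); lra.
Unshelve. all: by end_near. Qed.

End Dini.

Section HalfLine.
Context {R : realType}.
Implicit Types (u : R -> R) (c s t : R).

Lemma halfline_dnbhsP t (P : set R) : halfline_dnbhs t P <->
  exists2 d, 0 < d & forall s, 0 <= s -> s != t -> `|s - t| < d -> P s.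
Proof.
split=> [/nbhs_ballP[d /= d0 dP]|[d d0 dP]].
  exists d => // s s0 st std; apply: dP => //.
  by rewrite /ball/= distrC.
by apply/nbhs_ballP; exists d => // s; rewrite /ball/= distrC => ? ? ?; exact: dP.
Qed.

Lemma smooth_halfline_derivable u t : smooth_halfline u -> 0 <= t ->
  cvg (dquot u t @ halfline_dnbhs t).
Proof. by move=> u_smooth; exact: (u_smooth 0%N). Qed.

Lemma halfline_expansion u l t e : 0 < e ->
  dquot u t @ halfline_dnbhs t --> l ->
  exists2 d, 0 < d & forall s, 0 <= s -> `|s - t| < d ->
    `|u s - u t - (s - t) * l| <= e * `|s - t|.
Proof.
move=> e0 ul.
have : nbhs l [set y | `|y - l| <= e].
  by apply/nbhs_ballP; exists e => //= y; rewrite /ball/= distrC => /ltW.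
move=> /ul /halfline_dnbhsP[d d0 dP]; exists d => // s s0 sd.
have [->|st] := eqVneq s t; first by rewrite !subrr mul0r subrr normr0 mulr0.
have st0 : s - t != 0 by rewrite subr_eq0.
have := dP s s0 st sd; rewrite /dquot/=.
have -> : u s - u t - (s - t) * l = ((u s - u t) / (s - t) - l) * (s - t) by field.
by rewrite normrM => h; rewrite ler_wpM2r.
Qed.

Lemma halfline_expansion_right u l t e : 0 <= t -> 0 < e ->
  dquot u t @ halfline_dnbhs t --> l ->
  \forall s \near t^'+, `|u s - u t - (s - t) * l| <= e * (s - t).
Proof.
move=> t0 e0 /(halfline_expansion e0)[d d0 dP]; near=> s.
have ts : t < s by near: s; exact: nbhs_right_gt.
have sd : s - t < d by near: s; exact: nbhs_right_ltDr.
have st : `|s - t| = s - t by rewrite ger0_norm// subr_ge0 ltW.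
by have := dP s _ _; rewrite st; apply => //; lra.
Unshelve. all: by end_near. Qed.

Lemma dist_max c s t : `|Num.max c s - Num.max c t| <= `|s - t|.
Proof.
have := ler_norm (s - t); have := ler_norm (- (s - t)); rewrite normrN.
by case: (leP c s) => hs; case: (leP c t) => ht h1 h2; rewrite ler_norml;
  apply/andP; split; lra.
Qed.

(** Functions on the half-line are extended by their value at 0, so that
    they become continuous on the whole line. *)
Lemma halfline_clamp_continuous u :
  (forall t, 0 <= t -> cvg (dquot u t @ halfline_dnbhs t)) ->
  continuous (fun s => u (Num.max 0 s)).
Proof.
move=> du t; set t' := Num.max 0 t.
have t'0 : 0 <= t' by rewrite le_max lexx.
have [d d0 dP] := halfline_expansion ltr01 (du _ t'0).
set l := lim _ in dP.
have L0 : 0 < `|l| + 1 by rewrite ltr_wpDl.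
apply/cvgrPdist_le => e e0; near=> s.
have sd : `|s - t| < d.
  by rewrite distrC; near: s; exact: (@nbhsx_ballx _ _ t d d0).
have se : `|s - t| <= e / (`|l| + 1).
  rewrite distrC ltW//; near: s.
  by apply: (@nbhsx_ballx _ _ t); exact: divr_gt0.
have lip : `|Num.max 0 s - t'| <= `|s - t| by exact: dist_max.
have := dP (Num.max 0 s) _ (le_lt_trans lip sd).
rewrite le_max lexx => /(_ isT) h; rewrite distrC.
set y := Num.max 0 s in h lip *.
have : `|u y - u t'| <= (`|l| + 1) * `|y - t'|.
  have -> : u y - u t' = (u y - u t' - (y - t') * l) + (y - t') * l by ring.
  apply: le_trans (ler_normD _ _) _; rewrite normrM; lra.
move=> h2; apply: (le_trans h2); rewrite mulrC -ler_pdivlMr//.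
exact: le_trans lip se.
Unshelve. all: by end_near. Qed.

Lemma halfline_continuous u t :
  (forall s, 0 <= s -> cvg (dquot u s @ halfline_dnbhs s)) ->
  0 < t -> u @ t --> u t.
Proof.
move=> du t0; have := @halfline_clamp_continuous u du t; rewrite /continuous_at.
rewrite max_r ?(ltW t0)// => h.
apply: cvg_trans h; apply: near_eq_cvg; near=> s.
rewrite max_r//; near: s.
by apply: filterS (lt_nbhsr t0) => s /ltW.
Unshelve. all: by end_near. Qed.

(** The fundamental theorem of calculus, as a first-order expansion. *)
Lemma int0_expansion (a : R -> R) t e : continuous (fun s => a (Num.max 0 s)) ->
  0 < t -> 0 < e ->
  exists2 d, 0 < d & forall s, `|s - t| < d ->
    `|int0 a s - int0 a t - (s - t) * a t| <= e * `|s - t|.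
Proof.
set a' := fun s => _ => ca t0 e0.
have int0E s : int0 a s = \int[lebesgue_measure]_(z in `[0, s]) a' z.
  rewrite /int0; apply: eq_Rintegral => z; rewrite inE/= in_itv/= => /andP[z0 _].
  by rewrite /a' max_r.
have a't : a' t = a t by rewrite /a' max_r// ltW.
have int_a' : lebesgue_measure.-integrable `[0, t + 1] (EFin \o a').
  apply: continuous_compact_integrable; first exact: segment_compact.
  exact: continuous_subspaceT.
have tt1 : t < t + 1 by lra.
have [] := @continuous_FTC1 R a' (BLeft 0) t (t + 1) tt1 int_a' _ (ca t).
  exact: t0.
rewrite derive1E a't /derivable /derive => /[swap] -> /cvgrPdist_le.
move=> /(_ _ e0)/nbhs_ballP[d /= d0 dP]; exists d => // s sd.
have [->|st] := eqVneq s t; first by rewrite !subrr mul0r subrr normr0 mulr0.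
have st0 : s - t != 0 by rewrite subr_eq0.
have := dP (s - t); rewrite /ball/= sub0r normrN => /(_ sd st0).
rewrite /GRing.scale/= mulr1 subrK -!int0E => h.
have -> : int0 a s - int0 a t - (s - t) * a t =
  - (a t - (s - t)^-1 * (int0 a s - int0 a t)) * (s - t) by field.
by rewrite normrM normrN ler_wpM2r.
Qed.

End HalfLine.

(** * A comparison principle *)

Section Comparison.
Context {R : realType}.
Implicit Types (u v a rho : R -> R) (s t T c : R).

Lemma cvg_maxr (F : set_system R) c v (l : R) {FF : Filter F} :
  v @ F --> l -> Num.max c (v t) @[t --> F] --> Num.max c l.
Proof.
move=> /cvgrPdist_le vl; apply/cvgrPdist_le => e e0.
apply: filterS (vl e e0) => t; apply: le_trans; exact: dist_max.
Qed.

(** [dini_nonincreasing] applied to the maximum of c and v. *)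
Lemma dini_barrier v c T :
  (forall t, T < t -> v @ t^'- --> v t) ->
  (forall t e, T <= t -> 0 < e ->
     \forall s \near t^'+, v s <= Num.max c (v t) + e * (s - t)) ->
  forall t, T <= t -> v t <= Num.max c (v T).
Proof.
move=> vleft vdini t Tt.
suff : Num.max c (v t) <= Num.max c (v T) by rewrite ge_max => /andP[].
apply: (@dini_nonincreasing _ (fun t => Num.max c (v t)) T) => // {t Tt}.
  by move=> t Tt; apply: cvg_maxr; exact: vleft.
move=> t e Tt e0; near=> s.
have ts : t < s by near: s; exact: nbhs_right_gt.
have : v s <= Num.max c (v t) + e * (s - t) by near: s; exact: vdini.
move=> h; rewrite ge_max h andbT ler_wpDr ?le_max ?lexx//.
by rewrite mulr_ge0 ?(ltW e0)// subr_ge0 ltW.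
Unshelve. all: by end_near. Qed.

Lemma max_ge_convex k c x : 0 <= k -> k <= 1 ->
  (1 - k) * x + k * c <= Num.max c x.
Proof. by move=> k0 k1; case: (leP c x) => h; nra. Qed.

Lemma near_right_mul_le t k : \forall s \near t^'+, (s - t) * k <= 1.
Proof.
have k0 : 0 < `|k| + 1 by rewrite ltr_wpDl.
near=> s.
have ts : t < s by near: s; exact: nbhs_right_gt.
have : s - t < (`|k| + 1)^-1.
  by near: s; apply: nbhs_right_ltDr; rewrite invr_gt0.
rewrite -[X in _ < X]mul1r ltr_pdivlMr// => h.
by have := ler_norm k; nra.
Unshelve. all: by end_near. Qed.

(** While u exceeds eta and rho <= (eta / 4) a, the Dini derivative of u is at
    most - (eta / 4) a, so u + (eta / 4) int a is nonincreasing; as int a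
    diverges, u has to come below eta at some time. From then on eta is a
    barrier for u, since u is pushed down above it. *)
Lemma decay_comparison u a rho T : 0 < T ->
  continuous (fun s => a (Num.max 0 s)) -> (forall t, 0 <= t -> 0 < a t) ->
  int0 a t @[t --> +oo%R] --> +oo%R ->
  (forall t, T < t -> u @ t^'- --> u t) ->
  (forall t e, T <= t -> 0 < e -> \forall s \near t^'+,
     u s <= u t + (s - t) * (rho t - a t / 2 * u t + e)) ->
  (forall e, 0 < e -> \forall t \near +oo%R, rho t <= e * a t) ->
  forall eta, 0 < eta -> \forall t \near +oo%R, u t <= eta.
Proof.
move=> T0 ca a0 aoo uleft udini rhoa eta eta0.
have e4 : 0 < eta / 4 by rewrite divr_gt0.
have [T1 [T1T rhoT1]] : exists T1, T <= T1 /\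
    forall t, T1 <= t -> rho t <= eta / 4 * a t.
  have [M [_ MP]] := rhoa _ e4; exists (Num.max T (M + 1)).
  split=> [|t]; first by rewrite le_max lexx.
  by rewrite ge_max => /andP[_ Mt]; apply: MP; lra.
have [t1 [Tt1 ut1]] : exists t1, T1 <= t1 /\ u t1 <= eta.
  apply: contrapT => no.
  have big t : T1 <= t -> eta < u t.
    by move=> T1t; rewrite ltNge; apply/negP => ut; apply: no; exists t.
  pose v t := u t + eta / 4 * int0 a t.
  have vT1 : forall t, T1 <= t -> v t <= v T1.
    apply: dini_nonincreasing => [t T1t|t e T1t e0].
      apply: cvgD; first by apply: uleft; lra.
      apply: cvgM; first exact: cvg_cst.
      apply: cvg_at_left_filter; apply/cvgrPdist_le => e e0.
      have t0 : 0 < t by lra.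
      have [d d0 dP] := int0_expansion ca t0 ltr01.
      pose d' := Num.min d (e / (`|a t| + 1)).
      have A0 : 0 < `|a t| + 1 by rewrite ltr_wpDl.
      have d'0 : 0 < d' by rewrite lt_min d0 divr_gt0.
      near=> s.
      have : `|t - s| < d' by near: s; exact: (@nbhsx_ballx _ _ t d' d'0).
      rewrite distrC lt_min => /andP[sd se]; rewrite distrC.
      have := dP s sd; rewrite mul1r => h.
      have -> : int0 a s - int0 a t =
        (int0 a s - int0 a t - (s - t) * a t) + (s - t) * a t by ring.
      apply: le_trans (ler_normD _ _) _; rewrite normrM.
      by move: se; rewrite ltr_pdivlMr//; lra.
    have t0 : 0 < t by lra.
    have e2 : 0 < e / 2 by rewrite divr_gt0.
    (* the precision for int0 a: multiplied by eta / 4 it gives e / 2 *)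
    have ee : 0 < 2 * e / eta by rewrite divr_gt0// mulr_gt0.
    have [d d0 dP] := int0_expansion ca t0 ee.
    have Tt : T <= t by lra.
    near=> s.
    have ts : t < s by near: s; exact: nbhs_right_gt.
    have st : `|s - t| = s - t by rewrite ger0_norm// subr_ge0 ltW.
    have sd : s - t < d by near: s; exact: nbhs_right_ltDr.
    have us : u s <= u t + (s - t) * (rho t - a t / 2 * u t + e / 2).
      by near: s; exact: udini.
    have := dP s; rewrite st => /(_ sd); rewrite ler_norml => /andP[_ Is].
    have at0 : 0 < a t by apply: a0; lra.
    have rt := rhoT1 t T1t; have ut := big t T1t.
    have h1 : rho t - a t / 2 * u t <= - (eta / 4 * a t) by nra.
    have h2 : (s - t) * (rho t - a t / 2 * u t + e / 2) <=
      (s - t) * (- (eta / 4 * a t) + e / 2) by rewrite ler_wpM2l//; lra.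
    have h3 : eta / 4 * (int0 a s - int0 a t - (s - t) * a t) <=
      eta / 4 * (2 * e / eta * (s - t)) by rewrite ler_wpM2l// ltW.
    have h4 : eta / 4 * (2 * e / eta * (s - t)) = e / 2 * (s - t).
      by field; rewrite gt_eqF.
    by rewrite /v; lra.
  have /cvgryPge/(_ (4 / eta * v T1))[M [_ MP]] := aoo.
  pose t := Num.max T1 (M + 1).
  have T1t : T1 <= t by rewrite le_max lexx.
  have Mt : M < t by rewrite lt_max; apply/orP; right; lra.
  have := vT1 t T1t; have := MP t Mt; have := big t T1t; rewrite /v.
  set I := int0 a t => h1 h2.
  have : eta / 4 * (4 / eta * v T1) <= eta / 4 * I by rewrite ler_wpM2l// ltW.
  have -> : eta / 4 * (4 / eta * v T1) = v T1 by field; rewrite gt_eqF.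
  by rewrite /v; lra.
suff barrier t : t1 <= t -> u t <= Num.max eta (u t1).
  near=> t; have : u t <= Num.max eta (u t1); last by rewrite max_l.
  by apply: barrier; near: t; apply: nbhs_pinfty_ge; exact: num_real.
move: t; apply: dini_barrier => [t t1t|t e t1t e0].
  by apply: uleft; lra.
have Tt : T <= t by lra.
near=> s.
have ts : t < s by near: s; exact: nbhs_right_gt.
have us : u s <= u t + (s - t) * (rho t - a t / 2 * u t + e).
  by near: s; exact: udini.
have at0 : 0 < a t by apply: a0; lra.
have rt : rho t <= eta / 4 * a t by apply: rhoT1; lra.
have k1 : (s - t) * (a t / 2) <= 1 by near: s; exact: near_right_mul_le.
have k0 : 0 <= (s - t) * (a t / 2) by rewrite mulr_ge0//; lra.
have := max_ge_convex eta (u t) k0 k1.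
have : (s - t) * rho t <= (s - t) * (eta / 2 * a t) by rewrite ler_wpM2l//; nra.
by lra.
Unshelve. all: by end_near. Qed.

End Comparison.

(** * Contraction of the projected step and sensitivity of the solutions *)

Section Contraction.
Context {R : realType} {N : nat}.
Implicit Types q y z w : 'cV[R]_N.

(** The factor 1 - r1 is what the separate Lipschitz bounds on dF and dG give
    if the cross terms of |dF + d q + e dG|^2 are ignored. Those
    with dF.q and dG.q are compensated by the nonnegative first-order terms
    2 g (dF + e dG).q as soon as g d <= 1/2. The remaining one,
    2 g^2 e dF.dG <= g^2 e (|dF|^2 + |dG|^2), is absorbed in one
    of two ways. If |dG|^2 is at most half of its bound L |q|^2, the unused half
    of g^2 e^2 L |q|^2 suffices because e is large. Otherwise |q| is bounded by
    |dG|, and the cocoercivity term g e k |dG|^2 suffices because g is small. *)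
Lemma step_contraction q dF dG (g d e m L k : R) :
  0 < g -> 0 < e -> 0 <= m -> 0 < L ->
  g * d <= 1 / 2 -> 2 * m + L <= e * L -> g * (2 * m + L) <= k * L ->
  0 <= dotp dF q -> dotp dF dF <= m * dotp q q ->
  dotp dG dG <= L * dotp q q -> k * dotp dG dG <= dotp dG q ->
  dotp (q - g *: (dF + d *: q + e *: dG)) (q - g *: (dF + d *: q + e *: dG)) <=
  (1 - (- g ^+ 2 * (m + L * e ^+ 2 + d ^+ 2) + 2 * g * d)) * dotp q q.
Proof.
move=> g0 e0 m0 L0 gd eL gk dFq dFdF dGdG dGq.
have young : 2 * dotp dF dG <= dotp dF dF + dotp dG dG.
  by have := dotp_ge0 (dF - dG); rewrite !dotpE (dotpC dG dF); lra.
rewrite !dotpE (dotpC q dF) (dotpC q dG) (dotpC dG dF).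
have a0 := dotp_ge0 dF; have b0 := dotp_ge0 dG; have U0 := dotp_ge0 q.
move: young dFq dFdF dGdG dGq a0 b0 U0.
set a := dotp dF dF; set b := dotp dG dG; set U := dotp q q.
set p := dotp dF q; set r := dotp dG q; set c := dotp dF dG.
move=> young dFq dFdF dGdG dGq a0 b0 U0.
have gd1 : 1 <= 2 * (1 - g * d) by lra.
have k0 : 0 <= k.
  have : 0 <= k * L by apply: le_trans gk; rewrite mulr_ge0//; lra.
  by rewrite pmulr_lge0.
have r0 : 0 <= r by apply: le_trans dGq; rewrite mulr_ge0.
(* the cross term against the slack in the bound on dG and cocoercivity,
   after division by g * e *)
have key : g * (a + b) <= g * e * (L * U - b) + k * b.
  have aU : g * a <= g * (m * U) by rewrite ler_pM2l.
  have [small|large] := leP (2 * b) (L * U).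
    have h5 : g * (2 * b) <= g * (L * U) by rewrite ler_pM2l.
    have h1 : g * (L * U) <= 2 * (g * (L * U - b)) by lra.
    have h2 : (2 * m + L) * (g * U) <= e * L * (g * U).
      by rewrite ler_wpM2r// mulr_ge0// ltW.
    have h3 : e * (g * (L * U)) <= e * (2 * (g * (L * U - b))) by rewrite ler_pM2l.
    have h4 : 0 <= k * b by rewrite mulr_ge0.
    by lra.
  have h1 : g * (2 * m + L) * b <= k * L * b by rewrite ler_wpM2r.
  have h2 : g * m * (L * U) <= g * m * (2 * b).
    by rewrite ler_wpM2l ?(ltW large)// mulr_ge0// ltW.
  have h3 : 0 <= g * e * (L * U - b) by rewrite !mulr_ge0 ?(ltW g0) ?(ltW e0)//; lra.
  rewrite -(ler_pM2l L0).
  have h4 : L * (g * a) <= L * (g * (m * U)) by rewrite ler_pM2l.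
  have h5 : 0 <= L * (g * e * (L * U - b)) by rewrite mulr_ge0// ltW.
  by lra.
have h1 : g * e * (g * (a + b)) <= g * e * (g * e * (L * U - b) + k * b).
  by rewrite ler_pM2l// mulr_gt0.
have h2 : 0 <= g ^+ 2 * (m * U - a) by rewrite mulr_ge0 ?sqr_ge0//; lra.
have h3 : g * (p + e * r) <= g * (p + e * r) * (2 * (1 - g * d)).
  by rewrite ler_peMr// mulr_ge0 ?(ltW g0)// addr_ge0// mulr_ge0// ltW.
have h4 : g * (e * (k * b)) <= g * (e * r) by rewrite ler_pM2l// ler_pM2l.
have h5 : g * e * g * (2 * c) <= g * e * g * (a + b).
  by rewrite ler_pM2l// !mulr_gt0.
have h6 : 0 <= g * p by rewrite mulr_ge0 ?(ltW g0).
by lra.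
Qed.

Lemma dotp_le_coord w q (B : R) : 0 <= B ->
  (forall i, `|w i 0| <= B * enorm q) ->
  dotp w w <= N%:R * B ^+ 2 * dotp q q.
Proof.
move=> B0 wB; rewrite dotp_sqr -sqr_enorm -mulrA -exprMn.
have -> : N%:R * (B * enorm q) ^+ 2 = \sum_(i < N) (B * enorm q) ^+ 2.
  by rewrite sumr_const card_ord mulr_natl.
rewrite ler_sum// => i _.
by rewrite -real_normK ?num_real// ler_pXn2r ?nnegrE ?mulr_ge0 ?enorm_ge0.
Qed.

End Contraction.

Section Box.
Context {R : realType} {N : nat}.
Variable Om : 'I_N -> set R.
Hypothesis Om_nonempty : forall i, Om i !=set0.
Hypothesis Om_convex : forall i, convex_set (M := R^o) (Om i).
Hypothesis Om_compact : forall i, compact (Om i).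
Implicit Types (y z : 'cV[R]_N) (w : R) (Phi : 'cV[R]_N -> 'cV[R]_N).

Definition box_proj y : 'cV[R]_N := \col_i Defs.proj (Om i) (y i 0).

Lemma box_projP y : box Om (box_proj y).
Proof.
move=> i; rewrite mxE.
by have [] := projP (y i 0) (Om_nonempty i) (@Om_compact i).
Qed.

Lemma VI_box_coord Phi z i w : VI_sol (box Om) Phi z -> Om i w ->
  0 <= Phi z i 0 * (w - z i 0).
Proof.
move=> [zO zVI] Ow; have := zVI (set_coord z i w).
rewrite /dotp (bigD1 i)//= !mxE eqxx big1 ?addr0 => [|j /negbTE ji].
  rewrite mulrC; apply=> j; rewrite mxE.
  by case: eqP => [->|_]; [exact: Ow|exact: zO].
by rewrite !mxE ji subrr mul0r.
Qed.

(** The solution z of the VI is a fixed point of the projected step, and the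
    projection is nonexpansive in each coordinate. *)
Lemma box_proj_step Phi y z g : 0 <= g -> VI_sol (box Om) Phi z ->
  let s := y - z - g *: (Phi y - Phi z) in
  dotp (box_proj (y - g *: Phi y) - z) (box_proj (y - g *: Phi y) - z)
    <= dotp s s.
Proof.
move=> g0 zVI /=; rewrite !dotp_sqr ler_sum// => i _.
have := @proj_nonexpansive _ (Om i) ((y - g *: Phi y) i 0)
  ((z - g *: Phi z) i 0) (z i 0) (Om_nonempty i) (@Om_convex i) (@Om_compact i)
  (zVI.1 i).
rewrite !mxE => h.
have -> : y i 0 - z i 0 - g * (Phi y i 0 - Phi z i 0) =
  y i 0 - g * Phi y i 0 - (z i 0 - g * Phi z i 0) by ring.
apply: h => w Ow; have := VI_box_coord zVI Ow.
have -> : z i 0 - (z i 0 - g * Phi z i 0) = g * Phi z i 0 by ring.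
by rewrite -mulrA; exact: mulr_ge0.
Qed.

End Box.

Section RegularizedPath.
Context {R : realType} {N n : nat}.
Variables (A : 'M[R]_(n, N)) (b : 'cV[R]_n).
Variable f : 'I_N -> 'cV[R]_N -> R.
Hypothesis F_monotone : monotone_map (pseudo_gradient f).

Lemma gradient_penalty_monotone : monotone_map (gradient (penalty A b)).
Proof.
move=> x y; have [k k0 coco] := gradient_penalty_cocoercive A b.
by apply: le_trans (coco x y); rewrite mulr_ge0 ?dotp_ge0// ltW.
Qed.

(** Add the two VIs, each tested at the solution of the other. Monotonicity
    and the strong monotonicity modulus d bound d |z' - z|^2 by the change of
    the map at the point z', which is linear in the two parameters. *)
Lemma VI_lipschitz (K : set 'cV[R]_N) cx cp (d e d' e' : R) z z' :
  0 < d -> 0 <= e ->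
  (forall y, K y -> enorm y <= cx) ->
  (forall y, K y -> enorm (gradient (penalty A b) y) <= cp) ->
  VI_sol K (Phi_reg A b f d e) z -> VI_sol K (Phi_reg A b f d' e') z' ->
  enorm (z' - z) <= Num.max cx cp * (`|d' - d| + `|e' - e|) / d.
Proof.
move=> d0 e0 Kx Kp [Kz zVI] [Kz' zVI'].
have := zVI _ Kz'; have := zVI' _ Kz.
set G := gradient (penalty A b); set F := pseudo_gradient f.
set M := Num.max cx cp; pose W := enorm (z' - z).
have W0 : 0 <= W by exact: enorm_ge0.
have := F_monotone z' z; have := gradient_penalty_monotone z' z.
rewrite -/F -/G => Gm Fm.
have Mb (a : R) w : enorm w <= M -> - (a * dotp (z' - z) w) <= `|a| * (W * M).
  move=> wM; apply: le_trans (ler_norm _) _; rewrite normrN normrM ler_wpM2l//.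
  apply: (@le_trans _ _ (W * enorm w)); last by rewrite ler_wpM2l.
  rewrite ler_norml CauchySchwarz andbT lerNl -dotpNl.
  by apply: le_trans (CauchySchwarz _ _) _; rewrite enormN.
have hd : - ((d' - d) * dotp (z' - z) z') <= `|d' - d| * (W * M).
  by apply: Mb; rewrite le_max Kx.
have he : - ((e' - e) * dotp (z' - z) (G z')) <= `|e' - e| * (W * M).
  by apply: Mb; rewrite le_max Kp ?orbT.
rewrite -(opprB z' z) /Phi_reg -/F -/G => h1 h2.
have eG : 0 <= e * dotp (G z' - G z) (z' - z) by rewrite mulr_ge0.
have dW : d * W ^+ 2 <= W * (M * (`|d' - d| + `|e' - e|)).
  rewrite sqr_enorm; move: h1 h2 hd he Fm eG; rewrite !dotpE.
  rewrite !(dotpC _ z') !(dotpC _ z) (dotpC z z').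
  by lra.
rewrite ler_pdivlMr// -/W.
have [->|W1] := eqVneq W 0.
  by rewrite mul0r mulr_ge0 ?addr_ge0// le_max (le_trans (enorm_ge0 z))// Kx.
have Wp : 0 < W by rewrite lt_def W1.
by rewrite -(ler_pM2l Wp); move: dW; rewrite expr2; lra.
Qed.

End RegularizedPath.

(** * Relaxation trajectories and the rates *)

Section Trajectory.
Context {R : realType} {N : nat}.
Implicit Types (x p : R -> 'cV[R]_N) (s t : R).

Lemma cvg_enorm (F : set_system R) x (a : 'cV[R]_N) {FF : Filter F} :
  x @ F --> a -> enorm (x t) @[t --> F] --> enorm a.
Proof.
move=> xa; apply: (cvg_comp _ _ (cvg_dotp xa xa)); exact: sqrt_continuous.
Qed.

Lemma enorm_cvg0 (F : set_system R) x (a : 'cV[R]_N) {FF : Filter F} :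
  (forall e, 0 < e -> \forall t \near F, enorm (x t - a) <= e) -> x @ F --> a.
Proof.
move=> xa; apply/cvgrPdist_le => e e0; apply: filterS (xa e e0) => t.
by rewrite distrC; apply: le_trans (normr_le_enorm _).
Qed.

Lemma halfline_expansion_vec x (D : 'cV[R]_N) t e : 0 <= t -> 0 < e ->
  (forall i, dquot (fun s => x s i 0) t @ halfline_dnbhs t --> D i 0) ->
  \forall s \near t^'+, enorm (x s - x t - (s - t) *: D) <= e * (s - t).
Proof.
move=> t0 e0 xD.
have N0 : 0 < N%:R + 1 :> R by rewrite ltr_wpDl.
have e' : 0 < e / (N%:R + 1) by rewrite divr_gt0.
near=> s.
have ts : t < s by near: s; exact: nbhs_right_gt.
have xi : forall i, `|x s i 0 - x t i 0 - (s - t) * D i 0| <= e / (N%:R + 1) * (s - t).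
  near: s; apply: filter_forall => i; exact: halfline_expansion_right.
apply: le_trans (enorm_le_sum _) _.
apply: (@le_trans _ _ (\sum_(i < N) e / (N%:R + 1) * (s - t))).
  by apply: ler_sum => i _; rewrite !mxE.
rewrite sumr_const card_ord -[leLHS]mulr_natl mulrA ler_wpM2r//; first by lra.
by rewrite mulrCA ler_piMr ?(ltW e0)// ler_pdivrMr// mul1r lerDl.
Unshelve. all: by end_near. Qed.

Lemma trajectory_continuous x (D : R -> 'cV[R]_N) t :
  (forall s i, 0 <= s ->
     dquot (fun r => x r i 0) s @ halfline_dnbhs s --> D s i 0) ->
  0 < t -> x @ t --> x t.
Proof.
move=> xD t0; apply: cvg_colP => i.
apply: (@halfline_continuous _ (fun r => x r i 0)) => // s s0.
by apply/cvg_ex; exists (D s i 0); exact: xD.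
Qed.

(** Up to o(s - t), a trajectory of x' = sig (p - x) moves to a convex
    combination of x t and p t, so the distance to any fixed z contracts
    accordingly. *)
Lemma relaxation_step x p (sig : R -> R) (z : 'cV[R]_N) t e : 0 <= t -> 0 < e ->
  (forall i, dquot (fun r => x r i 0) t @ halfline_dnbhs t -->
     (sig t *: (p t - x t)) i 0) ->
  0 < sig t ->
  \forall s \near t^'+,
    [/\ t < s, (s - t) * sig t <= 1 & enorm (x s - z) <=
      (1 - (s - t) * sig t) * enorm (x t - z)
      + (s - t) * sig t * enorm (p t - z) + e * (s - t)].
Proof.
move=> t0 e0 xD sig0; near=> s.
have ts : t < s by near: s; exact: nbhs_right_gt.
have k1 : (s - t) * sig t <= 1 by near: s; exact: near_right_mul_le.
have k0 : 0 <= (s - t) * sig t by rewrite mulr_ge0 ?(ltW sig0)// subr_ge0 ltW.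
have h : enorm (x s - x t - (s - t) *: (sig t *: (p t - x t))) <= e * (s - t).
  by near: s; exact: halfline_expansion_vec.
split=> //.
have -> : x s - z = (1 - (s - t) * sig t) *: (x t - z)
    + ((s - t) * sig t) *: (p t - z)
    + (x s - x t - (s - t) *: (sig t *: (p t - x t))).
  by apply/colP => i; rewrite !mxE; ring.
apply: le_trans (enormD _ _) _; rewrite lerD//.
apply: le_trans (enormD _ _) _.
by rewrite !enormZ (ger0_norm k0) ger0_norm// subr_ge0.
Unshelve. all: by end_near. Qed.

(** A trajectory that always moves towards points of a ball never leaves a
    larger ball containing its initial value. *)
Lemma relaxation_bounded x p (sig : R -> R) c :
  (forall t i, 0 <= t -> dquot (fun r => x r i 0) t @ halfline_dnbhs t -->
     (sig t *: (p t - x t)) i 0) ->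
  (forall t, 0 <= t -> 0 < sig t) -> (forall t, 0 <= t -> enorm (p t) <= c) ->
  forall t, 0 <= t -> enorm (x t) <= Num.max c (enorm (x 0)).
Proof.
move=> xD sig0 pc; apply: dini_barrier => [t t0|t e t0 e0].
  apply: cvg_at_left_filter; apply: cvg_enorm.
  exact: (trajectory_continuous xD).
have xDt i : dquot (fun r => x r i 0) t @ halfline_dnbhs t -->
     (sig t *: (p t - x t)) i 0 by exact: xD.
apply: filterS (relaxation_step 0 t0 e0 xDt (sig0 t t0)) => s [ts k1].
rewrite !subr0 => h; apply: (le_trans h); rewrite lerD2r.
have k0 : 0 <= (s - t) * sig t by rewrite mulr_ge0 ?(ltW (sig0 t t0))// subr_ge0 ltW.
apply: le_trans (max_ge_convex _ _ k0 k1); rewrite lerD2l ler_wpM2l//.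
exact: pc.
Qed.

End Trajectory.

Section Rates.
Context {R : realType}.

Lemma near_pinfty_ge_gt0 (P : R -> Prop) : (\forall t \near +oo, P t) ->
  exists2 T, 0 < T & forall t, T <= t -> P t.
Proof.
move=> [M [_ MP]]; exists (Num.max 1 (M + 1)); first by rewrite lt_max ltr01.
by move=> t; rewrite ge_max => /andP[_ Mt]; apply: MP; lra.
Qed.

(** Positivity of r1 forces gam L eps^2 <= 2 delta. As delta tends to 0 and eps
    to infinity, gam tends to 0, which gives the three smallness conditions of
    [step_contraction]. *)
Lemma near_contractive (delta eps gam : R -> R) (m L k : R) :
  0 <= m -> 0 < L -> 0 < k ->
  (forall t, 0 <= t -> 0 < delta t) -> (forall t, 0 <= t -> 0 < gam t) ->
  (forall t, 0 <= t ->
    0 < - gam t ^+ 2 * (m + L * eps t ^+ 2 + delta t ^+ 2)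
        + 2 * gam t * delta t) ->
  delta t @[t --> +oo%R] --> (0 : R) -> eps t @[t --> +oo%R] --> +oo%R ->
  \forall t \near +oo%R, [/\ gam t * delta t <= 1 / 2,
    2 * m + L <= eps t * L & gam t * (2 * m + L) <= k * L].
Proof.
move=> m0 L0 k0 delta0 gam0 r0 dlim elim.
have mL : 0 < 2 * m + L by lra.
pose d0 := Num.min 1 (Num.min (L / 4) (k * L ^+ 2 / (2 * (2 * m + L)))).
have d00 : 0 < d0.
  by rewrite !lt_min ltr01 !divr_gt0// ?mulr_gt0 ?exprn_gt0.
near=> t.
have t0 : 0 <= t by near: t; apply: nbhs_pinfty_ge; exact: num_real.
have dt0 := delta0 t t0; have gt0 := gam0 t t0.
have : delta t <= d0.
  near: t; move/cvgrPdist_le : dlim => /(_ _ d00); apply: filterS => t.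
  by rewrite sub0r normrN; apply: le_trans (ler_norm _).
rewrite !le_min => /and3P[d1 d2 d3].
have e1 : (2 * m + L) / L <= eps t by near: t; move/cvgryPge : elim; apply.
have e2 : 2 * m + L <= eps t * L by rewrite -ler_pdivrMr.
have e3 : 1 <= eps t by apply: le_trans e1; rewrite ler_pdivlMr//; lra.
have gL : gam t * L <= 2 * delta t.
  have h : 0 < gam t * (2 * delta t - gam t * (m + L * eps t ^+ 2 + delta t ^+ 2)).
    by have := r0 t t0; lra.
  move: h; rewrite pmulr_rgt0// => h.
  have : gam t * (L * 1) <= gam t * (L * eps t ^+ 2).
    by rewrite ler_pM2l// ler_pM2l// exprn_ege1.
  have : 0 <= gam t * (m + delta t ^+ 2) by rewrite mulr_ge0 ?(ltW gt0)// addr_ge0 ?sqr_ge0.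
  by lra.
split=> //.
  have : gam t * delta t * L <= 1 / 2 * L.
    have : gam t * L * delta t <= gam t * L * 1.
      by rewrite ler_wpM2l// mulr_ge0// ltW.
    by lra.
  by rewrite ler_pM2r.
have : L * (gam t * (2 * m + L)) <= L * (k * L).
  have : gam t * L * (2 * m + L) <= 2 * delta t * (2 * m + L) by rewrite ler_wpM2r// ltW.
  by move: d3; rewrite ler_pdivlMr ?mulr_gt0//; lra.
by rewrite ler_pM2l.
Unshelve. all: by end_near. Qed.

Lemma r1_clamp_continuous (N : nat) (b1 b2 : R) (delta eps gam : R -> R) :
  (forall t, 0 <= t -> cvg (dquot delta t @ halfline_dnbhs t)) ->
  (forall t, 0 <= t -> cvg (dquot eps t @ halfline_dnbhs t)) ->
  (forall t, 0 <= t -> cvg (dquot gam t @ halfline_dnbhs t)) ->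
  continuous (fun s : R => r1 N b1 b2 delta eps gam (Num.max 0 s)).
Proof.
move=> /halfline_clamp_continuous cd /halfline_clamp_continuous ce.
move=> /halfline_clamp_continuous cg s.
have sq (u : R -> R) : continuous (fun s : R => u (Num.max 0 s)) ->
    u (Num.max 0 t) ^+ 2 @[t --> s] --> u (Num.max 0 s) ^+ 2.
  by move=> cu; apply: cvgM; exact: cu.
rewrite /continuous_at /r1.
apply: cvgD.
  apply: cvgM; first by apply: cvgN; exact: sq.
  apply: cvgD; last exact: sq.
  apply: cvgD; first exact: cvg_cst.
  by apply: cvgM; [exact: cvg_cst|exact: sq].
by apply: cvgM; [apply: cvgM; [exact: cvg_cst|exact: cg]|exact: cd].
Qed.

End Rates.

(** * Convergence of the dynamics *)

Theorem theorem1 (R : realType) (N n : nat)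
  (* the game *)
  (f : 'I_N -> 'cV[R]_N -> R) (Om : 'I_N -> set R)
  (A : 'M[R]_(n, N)) (b : 'cV[R]_n)
  (f_C2 : forall i, C2 (f i))
  (f_convex : forall i, convex_in_coord i (f i))
  (F_monotone : monotone_map (pseudo_gradient f))
  (Om_nonempty : forall i, Om i !=set0)
  (Om_convex : forall i, convex_set (M := R^o) (Om i))
  (Om_compact : forall i, compact (Om i))
  (Q_slater : slater A b Om)
  (* the parameters *)
  (delta eps sig gam : R -> R)
  (delta_smooth : smooth_halfline delta)
  (eps_smooth : smooth_halfline eps)
  (sig_smooth : smooth_halfline sig)
  (gam_smooth : smooth_halfline gam)
  (delta_gt0 : forall t, 0 <= t -> 0 < delta t)
  (eps_gt0 : forall t, 0 <= t -> 0 < eps t)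
  (sig_gt0 : forall t, 0 <= t -> 0 < sig t)
  (gam_gt0 : forall t, 0 <= t -> 0 < gam t)
  (* the solutions of the variational inequalities *)
  (xreg : R -> 'cV[R]_N)
  (xreg_sol : forall t, 0 <= t ->
     VI_sol (box Om) (Phi_reg A b f (delta t) (eps t)) (xreg t))
  (xstar : 'cV[R]_N)
  (xstar_veq : variational_equilibrium A b f Om xstar)
  (xstar_least : forall y, variational_equilibrium A b f Om y ->
     enorm xstar <= enorm y)
  (* the trajectory *)
  (x : R -> 'cV[R]_N)
  (x_sol : game_dynamics A b f Om delta eps sig gam x)
  (* the constants *)
  (c_x c_p c_0 c b1 b2 : R)
  (c_x_gt0 : 0 < c_x) (c_p_gt0 : 0 < c_p) (c_0_gt0 : 0 < c_0) (c_gt0 : 0 < c)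
  (b1_gt0 : 0 < b1) (b2_gt0 : 0 < b2)
  (c_x_bound : forall y, box Om y -> enorm y <= c_x)
  (c_p_bound : forall y, box Om y -> enorm (gradient (penalty A b) y) <= c_p)
  (c_bound : Num.max c_x c_p * c_0 <= c)
  (b1_lip : forall (i : 'I_N) (t : R) (y : 'cV[R]_N), 0 <= t ->
     enorm y <= enorm (x 0 - xreg 0) + c + c_x ->
     `|partial i (f i) y - partial i (f i) (xreg t)|
       <= b1 * enorm (y - xreg t))
  (b2_lip : forall (i : 'I_N) (y z : 'cV[R]_N),
     `|partial i (penalty A b) y - partial i (penalty A b) z|
       <= b2 * enorm (y - z))
  (* (i) *)
  (r1_bounds : forall t, 0 <= t ->
     0 < r1 N b1 b2 delta eps gam t /\ r1 N b1 b2 delta eps gam t < 1)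
  (r2_r1sig_lim :
     r2 delta eps t / (r1 N b1 b2 delta eps gam t * sig t)
       @[t --> +oo%R] --> (0 : R))
  (int_r1sig_lim :
     int0 (fun s => r1 N b1 b2 delta eps gam s * sig s) t
       @[t --> +oo%R] --> +oo%R)
  (weighted_r2_alt :
     (exists M : R, forall t, 0 <= t ->
        `|weighted_r2 N b1 b2 delta eps sig gam t| <= M) \/
     (weighted_r2 N b1 b2 delta eps sig gam t @[t --> +oo%R] --> +oo%R))
  (* (ii) *)
  (weighted_r2_le : forall t, 0 <= t ->
     weighted_r2 N b1 b2 delta eps sig gam t
       / expR (E_r1sig N b1 b2 delta eps sig gam t) <= c_0)
  (* (iii) *)
  (delta_lim : delta t @[t --> +oo%R] --> (0 : R))
  (delta2eps_lim : (delta t) ^+ 2 * eps t @[t --> +oo%R] --> +oo%R)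
  (eps_lim : eps t @[t --> +oo%R] --> +oo%R) :
  x t @[t --> +oo%R] --> xstar.
Proof.
(* without players everything is constant; otherwise the Lipschitz constant
   of the penalty gradient below is positive *)
case: (posnP N) => [N0|N0].
  subst N; rewrite (_ : x = cst xstar); first exact: cvg_cst.
  by apply/funext => t; rewrite !flatmx0.
pose M := Num.max c_x c_p.
have M0 : 0 < M by rewrite lt_max c_x_gt0.
pose p t := box_proj Om (x t - gam t *: Phi_reg A b f (delta t) (eps t) (x t)).
have pO t : box Om (p t) by exact: box_projP.
have xD t i : 0 <= t -> dquot (fun r => x r i 0) t @ halfline_dnbhs t -->
    (sig t *: (p t - x t)) i 0.
  move=> t0; have := x_sol t i t0; rewrite !mxE.
  set y1 := x t i 0 - _; set y2 := x t i 0 - _.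
  by have -> : y1 = y2 by rewrite /y1 /y2; ring.
have x_bounded t : 0 <= t -> enorm (x t) <= enorm (x 0 - xreg 0) + c + c_x.
  move=> t0; apply: le_trans (relaxation_bounded xD sig_gt0 _ t0) _.
    by move=> s _; apply: c_x_bound; exact: pO.
  have q0 := enorm_ge0 (x 0 - xreg 0).
  rewrite ge_max; apply/andP; split; first by lra.
  have := enormD (x 0 - xreg 0) (xreg 0); rewrite subrK.
  by have := c_x_bound _ (xreg_sol _ (lexx 0)).1; lra.
have xreg_lip s t : 0 <= s -> 0 <= t -> enorm (xreg s - xreg t) <=
    M * (`|delta s - delta t| + `|eps s - eps t|) / delta t.
  move=> s0 t0; apply: (VI_lipschitz F_monotone _ _ c_x_bound c_p_bound
    (xreg_sol t t0) (xreg_sol s s0)); first exact: delta_gt0.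
  exact/ltW/eps_gt0.
have u_continuous (t : R) : 0 < t ->
    enorm (x s - xreg s) @[s --> t] --> enorm (x t - xreg t).
  move=> t0; apply: cvg_enorm.
  apply: cvgB; first exact: (trajectory_continuous xD).
  have h : M * (`|delta s - delta t| + `|eps s - eps t|) / delta t @[s --> t] --> (0 : R).
    have -> : 0 = M * (`|delta t - delta t| + `|eps t - eps t|) / delta t.
      by rewrite !subrr normr0 addr0 mulr0 mul0r.
    apply: cvgM; last exact: cvg_cst.
    apply: cvgM; first exact: cvg_cst.
    by apply: cvgD; apply: cvg_norm; (apply: cvgB; last exact: cvg_cst);
      apply: halfline_continuous => // s; exact: smooth_halfline_derivable.
  apply: enorm_cvg0 => e e0; move/cvgrPdist_le : h => /(_ _ e0).
  apply: filterS2 (lt_nbhsr t0) => s s0; rewrite sub0r normrN => hs.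
  by apply: le_trans (xreg_lip s t (ltW s0) (ltW t0)) (le_trans (ler_norm _) hs).
pose m := N%:R * b1 ^+ 2; pose L := N%:R * b2 ^+ 2.
have m0 : 0 <= m by rewrite mulr_ge0 ?sqr_ge0.
have L0 : 0 < L by rewrite mulr_gt0 ?ltr0n// exprn_gt0.
have [k k0 coco] := gradient_penalty_cocoercive A b.
have contr : \forall t \near +oo, enorm (p t - xreg t) <=
    (1 - r1 N b1 b2 delta eps gam t / 2) * enorm (x t - xreg t).
  have r0 t : 0 <= t -> 0 < r1 N b1 b2 delta eps gam t.
    by move=> /r1_bounds[].
  have near_small := near_contractive m0 L0 k0 delta_gt0 gam_gt0 r0 delta_lim eps_lim.
  near=> t.
  have t0 : 0 <= t by near: t; apply: nbhs_pinfty_ge; exact: num_real.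
  have [gd eL gk] : [/\ gam t * delta t <= 1 / 2,
    2 * m + L <= eps t * L & gam t * (2 * m + L) <= k * L] by near: t.
  have g0 := gam_gt0 t t0; have e0 := eps_gt0 t t0.
  set q := x t - xreg t; set r := r1 _ _ _ _ _ _ _.
  have /andP[r_gt0 r_lt1] : (0 < r) && (r < 1) by apply/andP; exact: r1_bounds.
  apply: enorm_le; first by rewrite mulr_ge0 ?enorm_ge0//; lra.
  apply: (@le_trans _ _ ((1 - r) * dotp q q)); last first.
    by rewrite exprMn sqr_enorm ler_wpM2r ?dotp_ge0//; nra.
  apply: le_trans (box_proj_step Om_nonempty Om_convex Om_compact (x t) (ltW g0)
    (xreg_sol t t0)) _ => /=.
  set G := gradient (penalty A b); set F := pseudo_gradient f.
  have -> : Phi_reg A b f (delta t) (eps t) (x t) -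
      Phi_reg A b f (delta t) (eps t) (xreg t) =
    F (x t) - F (xreg t) + delta t *: q + eps t *: (G (x t) - G (xreg t)).
    by apply/colP => i; rewrite /Phi_reg -/F -/G /q !mxE; ring.
  apply: step_contraction => //.
  - exact: gk.
  - apply: dotp_le_coord => [|i]; first exact: ltW.
    by rewrite !mxE; apply: b1_lip => //; exact: x_bounded.
  - apply: dotp_le_coord => [|i]; first exact: ltW.
    by rewrite !mxE; exact: b2_lip.
have [T T0 contrT] := near_pinfty_ge_gt0 contr.
have u_lim : forall eta, 0 < eta -> \forall t \near +oo, enorm (x t - xreg t) <= eta.
  apply: (@decay_comparison _ _ (fun t => r1 N b1 b2 delta eps gam t * sig t)
    (fun t => M * r2 delta eps t) T).
  - exact: T0.
  - move=> s; apply: cvgM; first apply: r1_clamp_continuous => t.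
    + exact: smooth_halfline_derivable.
    + exact: smooth_halfline_derivable.
    + exact: smooth_halfline_derivable.
    by apply: halfline_clamp_continuous => t; exact: smooth_halfline_derivable.
  - by move=> t t0; rewrite mulr_gt0 ?sig_gt0//; have [] := r1_bounds t t0.
  - exact: int_r1sig_lim.
  - move=> t Tt; apply: cvg_at_left_filter; apply: u_continuous; lra.
  - move=> t e Tt e0; have t0 : 0 <= t by lra.
    have dt0 := delta_gt0 t t0.
    have e2 : 0 < e / 2 by rewrite divr_gt0.
    (* a precision e' on delta and eps costs 2 M e' / delta t = e / 2 on xreg *)
    pose e' := e * delta t / (4 * M).
    have e'0 : 0 < e' by rewrite divr_gt0 ?mulr_gt0.
    have ddelta := smooth_halfline_derivable delta_smooth t0.
    have deps := smooth_halfline_derivable eps_smooth t0.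
    near=> s.
    have [ts k1 xs] : [/\ t < s, (s - t) * sig t <= 1 & enorm (x s - xreg t) <=
        (1 - (s - t) * sig t) * enorm (x t - xreg t)
        + (s - t) * sig t * enorm (p t - xreg t) + e / 2 * (s - t)].
      near: s; apply: relaxation_step => //; last exact: sig_gt0.
      by move=> i; exact: xD.
    have dd : `|delta s - delta t - (s - t) * dot delta t| <= e' * (s - t).
      by near: s; exact: halfline_expansion_right.
    have de : `|eps s - eps t - (s - t) * dot eps t| <= e' * (s - t).
      by near: s; exact: halfline_expansion_right.
    have st0 : 0 < s - t by lra.
    have incr (w l : R) : `|w - (s - t) * l| <= e' * (s - t) ->
        `|w| <= (s - t) * (`|l| + e').
      move=> h; rewrite -[w](subrK ((s - t) * l)).
      apply: le_trans (ler_normD _ _) _; rewrite normrM (gtr0_norm st0); lra.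
    have h1 := incr _ _ dd; have h2 := incr _ _ de.
    have s0 : 0 <= s by lra.
    have h3 : enorm (xreg t - xreg s) <= (s - t) * (M * r2 delta eps t + e / 2).
      rewrite -(opprB (xreg s)) enormN; apply: le_trans (xreg_lip s t s0 t0) _.
      have -> : (s - t) * (M * r2 delta eps t + e / 2) =
        M * ((s - t) * (`|dot delta t| + e') + (s - t) * (`|dot eps t| + e')) / delta t.
        by rewrite /r2 /e'; field; rewrite !gt_eqF.
      by rewrite ler_pM2r ?invr_gt0// ler_pM2l// lerD.
    have h4 := enorm_triangle (xreg t) (x s) (xreg s).
    have h5 := contrT t Tt.
    have h6 : (s - t) * sig t * enorm (p t - xreg t) <= (s - t) * sig t *
      ((1 - r1 N b1 b2 delta eps gam t / 2) * enorm (x t - xreg t)).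
      by rewrite ler_wpM2l// mulr_ge0 ?(ltW st0)// ltW// sig_gt0.
    by lra.
  - move=> e e0; have eM : 0 < e / M by rewrite divr_gt0.
    near=> t.
    have t0 : 0 <= t by near: t; apply: nbhs_pinfty_ge; exact: num_real.
    have a0 : 0 < r1 N b1 b2 delta eps gam t * sig t.
      by rewrite mulr_gt0 ?sig_gt0//; have [] := r1_bounds t t0.
    have : r2 delta eps t / (r1 N b1 b2 delta eps gam t * sig t) <= e / M.
      near: t; move/cvgrPdist_le : r2_r1sig_lim => /(_ _ eM).
      by apply: filterS => t; rewrite sub0r normrN; apply: le_trans (ler_norm _).
    by rewrite ler_pdivrMr// mulrAC ler_pdivlMr// mulrC.
have xreg_lim : xreg @ +oo --> xstar.
  apply: (regularized_cvg Om_convex Om_compact Q_slater F_monotone _ c_x_bound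
    _ delta_lim delta2eps_lim xstar_veq xstar_least).
    move=> y; apply: (@cvg_colP _ _ _ (nbhs y)) => i; rewrite mxE.
    under eq_fun do rewrite mxE.
    exact: ((f_C2 i).1 i).2.
  near=> t.
  have t0 : 0 <= t by near: t; apply: nbhs_pinfty_ge; exact: num_real.
  by split; [exact: delta_gt0|exact: eps_gt0|exact: xreg_sol].
have -> : x = (fun t => (x t - xreg t) + xreg t).
  by apply/funext => t; rewrite subrK.
rewrite -[xstar]add0r; apply: cvgD; last exact: xreg_lim.
by apply: enorm_cvg0 => eta eta0; under eq_near do rewrite subr0; exact: u_lim.
Unshelve. all: by end_near. Qed.
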